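(* Let $G$ be a finite group, $H\subset G$ a subgroup, $d\in G$, $S=\mathrm{Stab}_H(dH)=H\cap dHd^{-1}$, $W$ a finite-dimensional complex representation of $S$ with character $\eta$, $\mathcal F_d(W)$ the object of the fusion category ${}^{G}_{H}\mathcal M_{H}$ corresponding to $W$, and $m\ge 1$ an integer. Set $E=C_G(d)\cap SC_G(S)\cap N_G(H)$. Then $SE=ES$ is a subgroup of $G$. Let $S'\subset SE$ be a subgroup. (1) Let $\mathfrak R'_d$ be a set of representatives of the orbits of $dH$ under the action of $S'$ on $dH$ by conjugation. Then $$\nu_m(\mathcal F_d(W))=\frac 1{|S|}\sum_{\substack{r\in\mathfrak R'_d\\ r^m\in S}}\frac{|S'|}{|S'\cap C_G(r)|}\,\overline\eta(r^m).$$ (2) Alternatively, let $S'$ act on $H$ by the twisted conjugation $s\,\tilde\triangleright\, h=(d^{-1}sd)\,h\,s^{-1}$ ($s\in S'$, $h\in H$), and let $\mathfrak T'_d$ be a set of representatives of the orbits of this action. Then $$\nu_m(\mathcal F_d(W))=\frac 1{|S|}\sum_{\substack{h\in\mathfrak T'_d\\ (dh)^m\in S}}\frac{|S'|}{|S'\cap C_G(dh)|}\,\overline\eta((dh)^m).$$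
   Context: All vector spaces and representations are finite-dimensional over $\mathbb C$; $\overline\eta$ denotes the complex conjugate of the character $\eta$. $C_G(\cdot)$ denotes centralizers (of an element or of a subgroup) and $N_G(H)$ the normalizer of $H$ in $G$. Where $r\in dH$ satisfies $r^m\in S$, the value $\overline\eta(r^m)$ makes sense. The category ${}^{G}_{H}\mathcal M_{H}$: objects are finite-dimensional $G$-graded complex vector spaces $M=\bigoplus_{g\in G}M_g$ that are $\mathbb CH$-bimodules with $|hmk|=h|m|k$ for $h,k\in H$ and homogeneous $m\in M$ (here $|m|$ is the degree). Morphisms are degree-preserving bimodule maps. The tensor product is $\otimes_{\mathbb CH}$ with $|m\otimes n|=|m||n|$, and the unit object is $\mathbb CH$ with $|h|=h$. This is a fusion category. The functor $\mathcal F_d$: for $d\in G$ let $S=\mathrm{Stab}_H(dH)=H\cap dHd^{-1}$ be the stabilizer of the coset $dH$ under left multiplication by $H$. The full subcategory of those objects $M$ all of whose homogeneous elements have degree in the double coset $HdH$ is equivalent to $\mathrm{Rep}(S)$, via the functor $M\mapsto (M_{dH})/H$, where $M_{dH}=\bigoplus_{g\in dH}M_g$, $/H$ denotes the quotient by the right $H$-action (i.e. by the span of all $mk-m$, $k\in H$), and $S$ acts through the left $H$-action. $\mathcal F_d$ denotes the inverse equivalence, regarded as a functor from $\mathrm{Rep}(S)$ to ${}^{G}_{H}\mathcal M_{H}$. Higher Frobenius-Schur indicators: ${}^{G}_{H}\mathcal M_{H}$ carries its canonical pivotal structure $j_V:V\to V^{\vee\vee}$, the one for which the pivotal dimension of every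 simple object is its Frobenius-Perron dimension. Write $V^\vee$ for the dual of $V$, with evaluation $\mathrm{ev}:V^\vee\otimes V\to I$ and coevaluation $\mathrm{db}_V:I\to V\otimes V^\vee$. For an object $V$ and an integer $m\ge1$, let $E_V^{(m)}$ be the linear endomorphism of $\mathrm{Hom}(I,V^{\otimes m})$ sending $f:I\to V\otimes V^{\otimes (m-1)}$ to $$I\xrightarrow{\mathrm{db}_{V^\vee}}V^\vee\otimes V^{\vee\vee}\xrightarrow{\mathrm{id}\otimes f\otimes \mathrm{id}}V^\vee\otimes V\otimes V^{\otimes(m-1)}\otimes V^{\vee\vee}\xrightarrow{\mathrm{ev}\otimes \mathrm{id}\otimes j_V^{-1}}V^{\otimes(m-1)}\otimes V$$ (it rotates the first tensor factor to the last place; associativity isomorphisms suppressed). The $m$-th indicator is $\nu_m(V):=\mathrm{Tr}(E_V^{(m)})$. *)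

(* Defs.v *)
From HB Require Import structures.
From mathcomp Require Import all_boot all_order all_algebra all_fingroup.
From mathcomp Require Import mxrepresentation.
From mathcomp Require Import complex reals.

Set Implicit Arguments.
Unset Strict Implicit.
Unset Printing Implicit Defensive.

Import GRing.Theory Num.Theory.
Local Open Scope ring_scope.

Section Linear.
Variables (F : fieldType) (V W : vectType F).

Lemma linfunE_lin (f : V -> W) : linear f -> linfun f =1 f.
Proof.
move=> lf; pose f' : {linear V -> W} := HB.pack f (GRing.isLinear.Build _ _ _ _ f lf).
exact: (lfunE f').
Qed.

Lemma lin_sum (f : V -> W) : linear f ->
  forall I (r : seq I) (P : pred I) (c : I -> F) (v : I -> V),
  f (\sum_(i <- r | P i) c i *: v i) = \sum_(i <- r | P i) c i *: f (v i).
Proof.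
move=> lf I r P c v; rewrite -(linfunE_lin lf) linear_sum.
by apply: eq_bigr => i _; rewrite linearZ -[in RHS](linfunE_lin lf).
Qed.

Definition stdb (U : vectType F) (i : 'I_(\dim {:U})) : U := (vbasis {:U})`_i.

Definition crd (U : vectType F) (i : 'I_(\dim {:U})) (u : U) : F :=
  coord (vbasis {:U}) i u.

Lemma stdb_crd (u : V) : u = \sum_i crd i u *: stdb i.
Proof. exact: coord_vbasis (memvf u). Qed.

Lemma crd_stdb (i j : 'I_(\dim {:V})) : crd i (stdb j) = (i == j)%:R.
Proof. rewrite eq_sym; apply: coord_free; exact: (basis_free (vbasisP _)). Qed.

Lemma crd_linear (i : 'I_(\dim {:V})) : linear (crd i : V -> F^o).
Proof. by move=> a u v; rewrite /crd linearP. Qed.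

End Linear.

Section Quotient.
Variables (F : fieldType) (V : vectType F) (U : {vspace V}).

(* The quotient V / U, carried by a complement of U; [qproj_ker] and [qsecK] say
   that [qproj] is surjective with kernel U. *)
Definition quotv : vectType F := subvs_of (U^C)%VS.

Definition qproj : 'Hom(V, quotv) :=
  linfun (fun v => vsproj (U^C)%VS (daddv_pi (U^C)%VS U v)).

Definition qsec : 'Hom(quotv, V) := linfun (@vsval F V (U^C)%VS).

Lemma qprojE v : qproj v = vsproj (U^C)%VS (daddv_pi (U^C)%VS U v).
Proof.
by rewrite linfunE_lin // => a u w; rewrite !linearP.
Qed.

Lemma qsecK x : qproj (qsec x) = x.
Proof.
rewrite qprojE lfunE /= daddv_pi_id ?subvsP ?vsvalK //.
by rewrite capvC capv_compl.
Qed.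

Lemma qproj_sec v : v - qsec (qproj v) \in U.
Proof.
have dUC : (U^C :&: U = 0)%VS by rewrite capvC capv_compl.
have vUC : v \in (U^C + U)%VS by rewrite addvC addv_complf memvf.
rewrite qprojE lfunE /= vsprojK ?memv_pi //.
by rewrite -{1}(daddv_pi_add dUC vUC) addrAC subrr add0r memv_pi.
Qed.

Lemma qproj_ker v : (qproj v == 0) = (v \in U).
Proof.
apply/eqP/idP => [v0 | vU]; first by have := qproj_sec v; rewrite v0 linear0 subr0.
have vUC: qsec (qproj v) \in (U :&: U^C)%VS.
  rewrite memv_cap; apply/andP; split.
    by rewrite -(memvN U) -[X in X \in _](addKr v) memvD ?memvN ?qproj_sec.
  by rewrite lfunE /= subvsP.
rewrite capv_compl memv0 in vUC.
by rewrite -[LHS]qsecK (eqP vUC) linear0.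
Qed.

End Quotient.


Section Bilinear.
Variables (F : fieldType) (M N X : vectType F).

Definition bilin (b : M -> N -> X) :=
  (forall n, linear (b^~ n)) /\ (forall m, linear (b m)).

(* The tensor product over F of M and N in coordinates: m (x) n is the matrix of
   products of coordinates. *)
Definition ptens (m : M) (n : N) : 'M[F]_(\dim {:M}, \dim {:N}) :=
  \matrix_(i, j) (crd i m * crd j n).

(* The linear map on M (x) N induced by a bilinear map b. *)
Definition plift (b : M -> N -> X) (x : 'M[F]_(\dim {:M}, \dim {:N})) : X :=
  \sum_i \sum_j x i j *: b (stdb i) (stdb j).

Lemma plift_linear b : linear (plift b).
Proof.
move=> a x y; rewrite /plift scaler_sumr -big_split; apply: eq_bigr => i _ /=.
rewrite scaler_sumr -big_split; apply: eq_bigr => j _ /=.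
by rewrite !mxE scalerDl scalerA.
Qed.

Lemma plift_ptens b m n : bilin b -> plift b (ptens m n) = b m n.
Proof.
case=> bl br; rewrite [in RHS](stdb_crd m) (lin_sum (bl n)).
apply: eq_bigr => i _; rewrite [in RHS](stdb_crd n) (lin_sum (br _)) scaler_sumr.
by apply: eq_bigr => j _; rewrite mxE scalerA.
Qed.

End Bilinear.

Section BilinTheory.
Variables (F : fieldType) (M N : vectType F).

Lemma ptens_bilin : bilin (@ptens F M N).
Proof.
split=> [n a m m' | m a n n']; apply/matrixP=> i j; rewrite !mxE.
  by rewrite (crd_linear i a m m') mulrDl -mulrA.
by rewrite (crd_linear j a n n') mulrDr mulrCA.
Qed.

Lemma ptens_span x : x = plift (@ptens F M N) x.
Proof.
rewrite {1}[x]matrix_sum_delta; apply: eq_bigr => i _; apply: eq_bigr => j _.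
congr (_ *: _); apply/matrixP => k l; rewrite !mxE !crd_stdb.
by rewrite mulr_natl; case: (k == i); case: (l == j).
Qed.

End BilinTheory.

Section Bimodules.
Variables (F : fieldType) (gT : finGroupType) (H : {group gT}).

(* A G-graded CH-bimodule.  The grading M = (+)_x M_x is given by its projections
   [gpr x] onto M_x.  The actions [gla], [gra] are only constrained on H. *)
Record gbimod := Gbimod {
  gcar :> vectType F;
  gpr : gT -> 'End(gcar);
  gla : gT -> 'End(gcar);
  gra : gT -> 'End(gcar);
  gprM : forall x y v, gpr x (gpr y v) = if x == y then gpr x v else 0;
  gpr_sum : forall v, \sum_x gpr x v = v;
  gla1 : forall v, gla 1%g v = v;
  gra1 : forall v, gra 1%g v = v;
  glaM : forall h k v, h \in H -> k \in H -> gla (h * k)%g v = gla h (gla k v);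
  graM : forall h k v, h \in H -> k \in H -> gra (h * k)%g v = gra k (gra h v);
  glra : forall h k v, h \in H -> k \in H -> gla h (gra k v) = gra k (gla h v);
  gla_pr : forall h x v, h \in H -> gla h (gpr x v) = gpr (h * x)%g (gla h v);
  gra_pr : forall k x v, k \in H -> gra k (gpr x v) = gpr (x * k)%g (gra k v)
}.

Arguments gpr {g} _.
Arguments gla {g} _.
Arguments gra {g} _.

Section Tensor.
Variables M N : gbimod.

(* The span of the m h (x) n - m (x) h n. *)
Definition bal : {vspace 'M[F]_(\dim {:M}, \dim {:N})} :=
  (\sum_(h in H) limg (linfun
     (plift (fun (m : M) (n : N) => ptens (gra h m) n - ptens m (gla h n)))))%VS.

Definition tcar : vectType F := quotv bal.

Definition tens (m : M) (n : N) : tcar := qproj bal (ptens m n).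

(* The linear map on M (x)_H N induced by b, meaningful when b is bilinear and
   balanced, see [blift_tens]. *)
Definition blift (X : vectType F) (b : M -> N -> X) : 'Hom(tcar, X) :=
  linfun (fun t => plift b (qsec bal t)).

Definition balanced (X : Type) (b : M -> N -> X) :=
  forall h m n, h \in H -> b (gra h m) n = b m (gla h n).

Lemma bilin_comp (X Y : vectType F) (f : X -> Y) (b : M -> N -> X) :
  linear f -> bilin b -> bilin (fun m n => f (b m n)).
Proof. by move=> lf [bl br]; split=> [n|m] a u v; rewrite ?bl ?br lf. Qed.

Lemma bilin_sum (I : Type) (r : seq I) (P : pred I) (X : vectType F)
    (b : I -> M -> N -> X) :
  (forall i, bilin (b i)) -> bilin (fun m n => \sum_(i <- r | P i) b i m n).
Proof.
move=> Hb; split=> [n|m] a u v; rewrite scaler_sumr -big_split;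
  by apply: eq_bigr => i _; case: (Hb i) => bl br; rewrite ?bl ?br.
Qed.

Lemma bilin_pre (M1 N1 : vectType F) (X : vectType F) (b : M -> N -> X)
  (f : M1 -> M) (g : N1 -> N) :
  linear f -> linear g -> bilin b -> bilin (fun m n => b (f m) (g n)).
Proof. by move=> lf lg [bl br]; split=> [n|m] a u v; rewrite ?lf ?lg ?bl ?br. Qed.

Lemma tens_bilin : bilin tens.
Proof. exact: (bilin_comp (@linearP _ _ _ _ (qproj bal)) (ptens_bilin M N)). Qed.

Lemma lfun_lin (X Y : vectType F) (f : 'Hom(X, Y)) : linear f.
Proof. exact: linearP. Qed.

Lemma tens_balanced : balanced tens.
Proof.
move=> h m n hH; apply/eqP; rewrite -subr_eq0 -linearB qproj_ker.
rewrite memvE; apply: (sumv_sup h) => //; rewrite -memvE.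
set b := (fun _ => _ : N -> _).
have bb : bilin b.
  have [bl br] := ptens_bilin M N.
  split=> [n'|m'] a u v; rewrite /b.
    by rewrite linearP !bl scalerBr opprD addrACA.
  by rewrite linearP !br scalerBr opprD addrACA.
apply/memv_imgP; exists (ptens m n); rewrite ?memvf //.
by rewrite (linfunE_lin (plift_linear b)) plift_ptens.
Qed.

Lemma bliftE (X : vectType F) (b : M -> N -> X) t : blift b t = plift b (qsec bal t).
Proof.
by rewrite linfunE_lin // => a u v; rewrite linearP plift_linear.
Qed.

Lemma blift_tens (X : vectType F) (b : M -> N -> X) m n :
  bilin b -> balanced b -> blift b (tens m n) = b m n.
Proof.
move=> bb bal_b; rewrite bliftE.
rewrite -[RHS](plift_ptens m n bb) -!(linfunE_lin (plift_linear b)).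
apply/esym/eqP; rewrite -subr_eq0 -linearB -memv_ker.
apply: subvP (qproj_sec bal (ptens m n)).
apply/subv_sumP => h hH; apply/subvP => _ /memv_imgP[x _ ->].
rewrite memv_ker; set c := (fun _ => _ : N -> _).
rewrite (linfunE_lin (plift_linear c)) /plift linear_sum big1 // => i _.
rewrite linear_sum big1 // => j _; rewrite linearZ linearB /=.
rewrite !(linfunE_lin (plift_linear b)) !plift_ptens // bal_b //.
by rewrite subrr scaler0.
Qed.

Lemma tens_ext (X : vectType F) (f g : 'Hom(tcar, X)) :
  (forall m n, f (tens m n) = g (tens m n)) -> f = g.
Proof.
move=> fg; apply/lfunP => t; rewrite -(qsecK t) [qsec _ _]ptens_span.
rewrite /plift !linear_sum; apply: eq_bigr => i _.
by rewrite !linear_sum; apply: eq_bigr => j _; rewrite !linearZ; congr (_ *: _); apply: fg.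
Qed.

End Tensor.


Definition tens_pr (M N : gbimod) x : 'End(tcar M N) :=
  blift (fun m n => \sum_y tens (gpr y m) (gpr (y^-1 * x)%g n)).
Definition tens_la (M N : gbimod) h : 'End(tcar M N) := blift (fun m n => tens (gla h m) n).
Definition tens_ra (M N : gbimod) k : 'End(tcar M N) := blift (fun m n => tens m (gra k n)).

Lemma lin_id (V : vectType F) : linear (@id V). Proof. by []. Qed.

Lemma tens_prE (M N : gbimod) x (m : M) (n : N) :
  tens_pr M N x (tens m n) = \sum_y tens (gpr y m) (gpr (y^-1 * x)%g n).
Proof.
apply: blift_tens.
  apply: bilin_sum => y.
  by apply: bilin_pre; [exact: lfun_lin | exact: lfun_lin | exact: tens_bilin].
move=> h m' n' hH; rewrite (reindex_inj (mulIg h)); apply: eq_bigr => y _ /=.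
rewrite -gra_pr // tens_balanced // gla_pr //; congr (tens _ (gpr _ _)).
by rewrite invMg !mulgA mulgV mul1g.
Qed.

Lemma tens_laE (M N : gbimod) h (m : M) (n : N) :
  h \in H -> tens_la M N h (tens m n) = tens (gla h m) n.
Proof.
move=> hH; apply: blift_tens.
  by apply: bilin_pre; [exact: lfun_lin | exact: lin_id | exact: tens_bilin].
by move=> k m' n' kH; rewrite glra // tens_balanced.
Qed.

Lemma tens_raE (M N : gbimod) k (m : M) (n : N) :
  k \in H -> tens_ra M N k (tens m n) = tens m (gra k n).
Proof.
move=> kH; apply: blift_tens.
  by apply: bilin_pre; [exact: lin_id | exact: lfun_lin | exact: tens_bilin].
by move=> h m' n' hH; rewrite -glra // tens_balanced.
Qed.

Lemma tens_ext_v (M N : gbimod) (X : vectType F) (f g : 'Hom(tcar M N, X)) :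
  (forall m n, f (tens m n) = g (tens m n)) -> f =1 g.
Proof. by move/tens_ext => ->. Qed.

Lemma tens0l (M N : gbimod) (n : N) : tens (0 : M) n = 0.
Proof.
have [bl _] := tens_bilin M N.
by have := bl n (-1) 0 0; rewrite scaler0 addr0 scaleN1r addNr.
Qed.
Lemma tens0r (M N : gbimod) (m : M) : tens m (0 : N) = 0.
Proof.
have [_ br] := tens_bilin M N.
by have := br m (-1) 0 0; rewrite scaler0 addr0 scaleN1r addNr.
Qed.
Lemma tensDl (M N : gbimod) (m m' : M) (n : N) :
  tens (m + m') n = tens m n + tens m' n.
Proof. by have [bl _] := tens_bilin M N; have := bl n 1 m m'; rewrite !scale1r. Qed.
Lemma tensDr (M N : gbimod) (m : M) (n n' : N) :
  tens m (n + n') = tens m n + tens m n'.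
Proof. by have [_ br] := tens_bilin M N; have := br m 1 n n'; rewrite !scale1r. Qed.
Lemma tensZl (M N : gbimod) a (m : M) (n : N) : tens (a *: m) n = a *: tens m n.
Proof.
by have [bl _] := tens_bilin M N; have := bl n a m 0; rewrite !addr0 tens0l addr0.
Qed.
Lemma tensZr (M N : gbimod) a (m : M) (n : N) : tens m (a *: n) = a *: tens m n.
Proof.
by have [_ br] := tens_bilin M N; have := br m a n 0; rewrite !addr0 tens0r addr0.
Qed.
Lemma tens_suml (M N : gbimod) I (r : seq I) (P : pred I) (m : I -> M) (n : N) :
  tens (\sum_(i <- r | P i) m i) n = \sum_(i <- r | P i) tens (m i) n.
Proof.
elim/big_rec2: _ => [|i x y _ <-]; [exact: tens0l | exact: tensDl].
Qed.
Lemma tens_sumr (M N : gbimod) I (r : seq I) (P : pred I) (m : M) (n : I -> N) :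
  tens m (\sum_(i <- r | P i) n i) = \sum_(i <- r | P i) tens m (n i).
Proof.
elim/big_rec2: _ => [|i x y _ <-]; [exact: tens0r | exact: tensDr].
Qed.

Section TensorObject.
Variables M N : gbimod.
Implicit Type v : tcar M N.

Lemma tens_gprM x y v :
  tens_pr M N x (tens_pr M N y v) = if x == y then tens_pr M N x v else 0.
Proof.
have -> : (if x == y then tens_pr M N x v else 0)
  = (if x == y then tens_pr M N x else 0) v by case: ifP; rewrite ?zero_lfunE.
rewrite -comp_lfunE; move: v; apply: tens_ext_v => m n.
rewrite comp_lfunE tens_prE linear_sum /=.
transitivity (\sum_z if x == y then tens (gpr z m) (gpr (z^-1 * x)%g n) else 0).
  apply: eq_bigr => z _; rewrite tens_prE (bigD1 z) //= big1 ?addr0.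
    rewrite !gprM eqxx (inj_eq (mulgI _)).
    by case: eqP => // _; rewrite tens0r.
  by move=> t /negPf tz; rewrite gprM tz tens0l.
case: eqP => _; first by rewrite tens_prE.
by rewrite big1 // zero_lfunE.
Qed.

Lemma tens_gpr_sum v : \sum_x tens_pr M N x v = v.
Proof.
rewrite -[RHS]id_lfunE -sum_lfunE; move: v; apply: tens_ext_v => m n.
rewrite sum_lfunE id_lfunE.
rewrite (eq_bigr _ (fun x _ => tens_prE x m n)).
rewrite exchange_big /= -[in RHS](gpr_sum m) tens_suml; apply: eq_bigr => y _.
by rewrite -tens_sumr -[in RHS](gpr_sum n) [in RHS](reindex_inj (mulgI (y^-1)%g)).
Qed.

Lemma tens_gla1 v : tens_la M N 1%g v = v.
Proof.
rewrite -[RHS]id_lfunE; move: v; apply: tens_ext_v => m n.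
by rewrite tens_laE // id_lfunE gla1.
Qed.

Lemma tens_gra1 v : tens_ra M N 1%g v = v.
Proof.
rewrite -[RHS]id_lfunE; move: v; apply: tens_ext_v => m n.
by rewrite tens_raE // id_lfunE gra1.
Qed.

Lemma tens_glaM h k v : h \in H -> k \in H ->
  tens_la M N (h * k)%g v = tens_la M N h (tens_la M N k v).
Proof.
move=> hH kH; rewrite -comp_lfunE; move: v; apply: tens_ext_v => m n.
by rewrite comp_lfunE !tens_laE ?groupM // glaM.
Qed.

Lemma tens_graM h k v : h \in H -> k \in H ->
  tens_ra M N (h * k)%g v = tens_ra M N k (tens_ra M N h v).
Proof.
move=> hH kH; rewrite -comp_lfunE; move: v; apply: tens_ext_v => m n.
by rewrite comp_lfunE !tens_raE ?groupM // graM.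
Qed.

Lemma tens_glra h k v : h \in H -> k \in H ->
  tens_la M N h (tens_ra M N k v) = tens_ra M N k (tens_la M N h v).
Proof.
move=> hH kH; rewrite -!comp_lfunE; move: v; apply: tens_ext_v => m n.
by rewrite !comp_lfunE tens_raE // !tens_laE // tens_raE.
Qed.

Lemma tens_gla_pr h x v : h \in H ->
  tens_la M N h (tens_pr M N x v) = tens_pr M N (h * x)%g (tens_la M N h v).
Proof.
move=> hH; rewrite -!comp_lfunE; move: v; apply: tens_ext_v => m n.
rewrite !comp_lfunE tens_laE // !tens_prE linear_sum /=.
rewrite [RHS](reindex_inj (mulgI h)); apply: eq_bigr => y _.
by rewrite tens_laE // gla_pr // invMg -mulgA mulKg.
Qed.

Lemma tens_gra_pr k x v : k \in H ->
  tens_ra M N k (tens_pr M N x v) = tens_pr M N (x * k)%g (tens_ra M N k v).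
Proof.
move=> hH; rewrite -!comp_lfunE; move: v; apply: tens_ext_v => m n.
rewrite !comp_lfunE tens_raE // !tens_prE linear_sum /=.
by apply: eq_bigr => y _; rewrite tens_raE // gra_pr // mulgA.
Qed.

Canonical tensor : gbimod :=
  Gbimod tens_gprM tens_gpr_sum tens_gla1 tens_gra1 tens_glaM tens_graM tens_glra
    tens_gla_pr tens_gra_pr.

End TensorObject.

(* CH, as functions on H: a stands for the sum of the a(h) h. *)
Definition ucar : vectType F := {ffun subg_of H -> F^o}.

Definition unit_pr x : 'End(ucar) :=
  linfun (fun a : ucar => [ffun z : subg_of H => if val z == x then a z else 0] : ucar).
Definition unit_la h : 'End(ucar) :=
  linfun (fun a : ucar => [ffun z : subg_of H => a ((subg H h)^-1 * z)%g] : ucar).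
Definition unit_ra k : 'End(ucar) :=
  linfun (fun a : ucar => [ffun z : subg_of H => a (z * (subg H k)^-1)%g] : ucar).

Lemma unit_prE x a z : unit_pr x a z = if val z == x then a z else 0.
Proof.
rewrite linfunE_lin ?ffunE // => c u v; apply/ffunP => t.
by rewrite !ffunE; case: eqP => // _; rewrite scaler0 addr0.
Qed.
Lemma unit_laE h a z : unit_la h a z = a ((subg H h)^-1 * z)%g.
Proof.
by rewrite linfunE_lin ?ffunE // => c u v; apply/ffunP => t; rewrite !ffunE.
Qed.
Lemma unit_raE k a z : unit_ra k a z = a (z * (subg H k)^-1)%g.
Proof.
by rewrite linfunE_lin ?ffunE // => c u v; apply/ffunP => t; rewrite !ffunE.
Qed.

Lemma unit_gprM x y v : unit_pr x (unit_pr y v) = if x == y then unit_pr x v else 0.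
Proof.
apply/ffunP => z; rewrite !unit_prE.
case: (eqVneq x y) => [<-|xy]; rewrite ?unit_prE; first by case: eqP.
by rewrite ffunE; case: eqP => // ->; rewrite (negPf xy).
Qed.
Lemma unit_gpr_sum v : \sum_x unit_pr x v = v.
Proof.
apply/ffunP => z; rewrite sum_ffunE (bigD1 (val z)) //= unit_prE eqxx big1 ?addr0 //.
by move=> x xz; rewrite unit_prE eq_sym (negPf xz).
Qed.
Lemma subg1 : subg H 1%g = 1%g. Proof. exact: morph1. Qed.
Lemma unit_gla1 v : unit_la 1%g v = v.
Proof. by apply/ffunP => z; rewrite unit_laE subg1 invg1 mul1g. Qed.
Lemma unit_gra1 v : unit_ra 1%g v = v.
Proof. by apply/ffunP => z; rewrite unit_raE subg1 invg1 mulg1. Qed.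
Lemma unit_glaM h k v : h \in H -> k \in H -> unit_la (h * k)%g v = unit_la h (unit_la k v).
Proof.
by move=> hH kH; apply/ffunP => z; rewrite !unit_laE morphM // invMg mulgA.
Qed.
Lemma unit_graM h k v : h \in H -> k \in H -> unit_ra (h * k)%g v = unit_ra k (unit_ra h v).
Proof.
by move=> hH kH; apply/ffunP => z; rewrite !unit_raE morphM // invMg mulgA.
Qed.
Lemma unit_glra h k v : h \in H -> k \in H -> unit_la h (unit_ra k v) = unit_ra k (unit_la h v).
Proof.
by move=> hH kH; apply/ffunP => z; rewrite !(unit_raE, unit_laE) mulgA.
Qed.
Lemma unit_gla_pr h x v : h \in H -> unit_la h (unit_pr x v) = unit_pr (h * x)%g (unit_la h v).
Proof.
move=> hH; apply/ffunP => z; rewrite !(unit_prE, unit_laE) /=.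
by rewrite (can2_eq (mulKVg _) (mulKg _)) subgK.
Qed.
Lemma unit_gra_pr k x v : k \in H -> unit_ra k (unit_pr x v) = unit_pr (x * k)%g (unit_ra k v).
Proof.
move=> hH; apply/ffunP => z; rewrite !(unit_prE, unit_raE) /=.
by rewrite (can2_eq (mulgKV _) (mulgK _)) subgK.
Qed.

Canonical gunit : gbimod :=
  Gbimod unit_gprM unit_gpr_sum unit_gla1 unit_gra1 unit_glaM unit_graM unit_glra
    unit_gla_pr unit_gra_pr.

Definition pullback (X Y : vectType F) (f : 'Hom(X, Y)) :
    'Hom('Hom(Y, F^o), 'Hom(X, F^o)) :=
  linfun (fun phi : 'Hom(Y, F^o) => (phi \o f)%VF).

Lemma pullbackE (X Y : vectType F) (f : 'Hom(X, Y)) phi x : pullback f phi x = phi (f x).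
Proof.
rewrite linfunE_lin ?comp_lfunE // => a u v.
by rewrite comp_lfunDl comp_lfunZl.
Qed.

(* The dual object is carried by the linear dual of M.  It stands for the right
   H-linear maps M -> CH, the linear form phi corresponding to
   m |-> \sum_k phi (m k^-1) k, which is what [ev] computes.
   [snakeL] and [snakeR] are the duality axioms. *)
Section Dual.
Variable M : gbimod.
Definition dual_car : vectType F := 'Hom(M, F^o).
Definition dual_pr x : 'End(dual_car) := pullback (gpr (x^-1)%g).
Definition dual_la h : 'End(dual_car) := pullback (gra h).
Definition dual_ra k : 'End(dual_car) := pullback (gla k).
Implicit Type v : dual_car.

Lemma dual_gprM x y v : dual_pr x (dual_pr y v) = if x == y then dual_pr x v else 0.
Proof.
apply/lfunP => m; rewrite !pullbackE gprM (inj_eq invg_inj) eq_sym.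
by case: eqP => [->|_]; rewrite ?pullbackE // linear0 zero_lfunE.
Qed.
Lemma dual_gpr_sum v : \sum_x dual_pr x v = v.
Proof.
apply/lfunP => m; rewrite sum_lfunE -[in RHS](gpr_sum m) linear_sum /=.
rewrite [RHS](reindex_inj invg_inj); apply: eq_bigr => x _.
by rewrite pullbackE.
Qed.
Lemma dual_gla1 v : dual_la 1%g v = v.
Proof. by apply/lfunP => m; rewrite pullbackE gra1. Qed.
Lemma dual_gra1 v : dual_ra 1%g v = v.
Proof. by apply/lfunP => m; rewrite pullbackE gla1. Qed.
Lemma dual_glaM h k v : h \in H -> k \in H -> dual_la (h * k)%g v = dual_la h (dual_la k v).
Proof. by move=> hH kH; apply/lfunP => m; rewrite !pullbackE graM. Qed.
Lemma dual_graM h k v : h \in H -> k \in H -> dual_ra (h * k)%g v = dual_ra k (dual_ra h v).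
Proof. by move=> hH kH; apply/lfunP => m; rewrite !pullbackE glaM. Qed.
Lemma dual_glra h k v : h \in H -> k \in H -> dual_la h (dual_ra k v) = dual_ra k (dual_la h v).
Proof. by move=> hH kH; apply/lfunP => m; rewrite !pullbackE glra. Qed.
Lemma dual_gla_pr h x v : h \in H -> dual_la h (dual_pr x v) = dual_pr (h * x)%g (dual_la h v).
Proof.
move=> hH; apply/lfunP => m; rewrite !pullbackE gra_pr // invMg.
by rewrite mulgKV.
Qed.
Lemma dual_gra_pr k x v : k \in H -> dual_ra k (dual_pr x v) = dual_pr (x * k)%g (dual_ra k v).
Proof.
move=> hH; apply/lfunP => m; rewrite !pullbackE gla_pr // invMg.
by rewrite mulKVg.
Qed.
Canonical dual : gbimod :=
  Gbimod dual_gprM dual_gpr_sum dual_gla1 dual_gra1 dual_glaM dual_graM dual_glra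
    dual_gla_pr dual_gra_pr.
End Dual.


(* The space of morphisms; see [homsP]. *)
Definition homs (M N : gbimod) : {vspace 'Hom(M, N)} :=
  ((\bigcap_(x : gT) lker (linfun (fun f : 'Hom(M, N) =>
      (f \o @gpr M x) - (@gpr N x \o f))))
   :&: (\bigcap_(h in H) lker (linfun (fun f : 'Hom(M, N) =>
      (f \o @gla M h) - (@gla N h \o f))))
   :&: (\bigcap_(k in H) lker (linfun (fun f : 'Hom(M, N) =>
      (f \o @gra M k) - (@gra N k \o f)))))%VS%VF.

Definition tensm (M M' N N' : gbimod) (f : 'Hom(M, M')) (g : 'Hom(N, N')) :
    'Hom(tensor M N, tensor M' N') :=
  blift (fun m n => tens (f m) (g n)).

(* Associativity and unit isomorphisms; a trailing V marks an inverse. *)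
Definition assoc (M N P : gbimod) :
    'Hom(tensor (tensor M N) P, tensor M (tensor N P)) :=
  blift (fun (t : tensor M N) (p : P) =>
    blift (fun (m : M) (n : N) => tens m (tens n p : tensor N P)) t).

Definition assocV (M N P : gbimod) :
    'Hom(tensor M (tensor N P), tensor (tensor M N) P) :=
  blift (fun (m : M) (t : tensor N P) =>
    blift (fun (n : N) (p : P) => tens (tens m n : tensor M N) p) t).

Definition ucoef (a : gunit) (h : subg_of H) : F := (a : {ffun subg_of H -> F^o}) h.

Definition uone : gunit := [ffun z : subg_of H => (z == 1%g)%:R : F^o].

Definition lunit (M : gbimod) : 'Hom(tensor gunit M, M) :=
  blift (fun (a : gunit) (m : M) => \sum_(h : subg_of H) ucoef a h *: gla (val h) m).

Definition runitV (M : gbimod) : 'Hom(M, tensor M gunit) :=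
  linfun (fun m => tens m uone).

Definition ev (M : gbimod) : 'Hom(tensor (dual M) M, gunit) :=
  blift (fun (phi : dual M) (m : M) =>
    [ffun k : subg_of H => (phi : 'Hom(M, F^o)) (gra (val k)^-1%g m)] : ucar).

(* The image of 1 under coevaluation.  The factor 1/|H| comes from summing over a
   basis of M over F, rather than over CH. *)
Definition casimir (M : gbimod) : tensor M (dual M) :=
  #|H|%:R^-1 *:
    \sum_i tens (stdb i : M) (linfun (crd i : M -> F^o) : dual M).

Definition db (M : gbimod) : 'Hom(gunit, tensor M (dual M)) :=
  linfun (fun a : gunit => \sum_(h : subg_of H) ucoef a h *: gla (val h) (casimir M)).

Lemma homsP (M N : gbimod) (f : 'Hom(M, N)) :
  reflect [/\ forall x v, f (gpr x v) = gpr x (f v),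
              forall h v, h \in H -> f (gla h v) = gla h (f v)
            & forall k v, k \in H -> f (gra k v) = gra k (f v)]
          (f \in homs M N).
Proof.
have key (p : 'End(M)) (q : 'End(N)) :
    (f \in lker (linfun (fun f : 'Hom(M, N) => (f \o p) - (q \o f))%VF))
    = (f \o p == q \o f)%VF.
  rewrite memv_ker linfunE_lin ?subr_eq0 // => a u v.
  rewrite comp_lfunDl comp_lfunDr -comp_lfunZl -comp_lfunZr opprD addrACA.
  by rewrite scalerBr.
rewrite !memv_cap -andbA; apply: (iffP and3P).
  case; rewrite !memvE => /subv_bigcapP Hp /subv_bigcapP Hl /subv_bigcapP Hr; split.
  - move=> x v; have := Hp x isT; rewrite -memvE key => /eqP/lfunP/(_ v).
    by rewrite !comp_lfunE.
  - move=> h v hH; have := Hl h hH; rewrite -memvE key => /eqP/lfunP/(_ v).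
    by rewrite !comp_lfunE.
  - move=> k v kH; have := Hr k kH; rewrite -memvE key => /eqP/lfunP/(_ v).
    by rewrite !comp_lfunE.
case=> Hp Hl Hr; split; rewrite memvE; apply/subv_bigcapP => x xH;
  rewrite -memvE key; apply/eqP/lfunP => v; rewrite !comp_lfunE ?Hp ?Hl ?Hr //.
Qed.

Lemma tensmE (M M' N N' : gbimod) (f : 'Hom(M, M')) (g : 'Hom(N, N')) m n :
  f \in homs M M' -> g \in homs N N' -> tensm f g (tens m n) = tens (f m) (g n).
Proof.
move=> /homsP[_ _ fr] /homsP[_ gl _]; apply: blift_tens.
  by apply: bilin_pre; [exact: lfun_lin | exact: lfun_lin | exact: tens_bilin].
by move=> h m' n' hH /=; rewrite fr // gl // tens_balanced.
Qed.

Lemma blift_lin (M N : gbimod) (X : vectType F) (a : F) (b1 b2 b : M -> N -> X) :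
  (forall m n, b m n = a *: b1 m n + b2 m n) ->
  forall t, blift b t = a *: blift b1 t + blift b2 t.
Proof.
move=> Hb t; rewrite !bliftE /plift scaler_sumr -big_split; apply: eq_bigr => i _.
rewrite scaler_sumr -big_split; apply: eq_bigr => j _ /=.
by rewrite Hb scalerDr !scalerA mulrC.
Qed.

Lemma assocE (M N P : gbimod) (m : M) (n : N) (p : P) :
  assoc M N P (tens (tens m n : tensor M N) p) = tens m (tens n p : tensor N P).
Proof.
have bb (q : P) : bilin (fun (m : M) (n : N) => tens m (tens n q : tensor N P)).
  by split=> [n'|m'] a u v; rewrite ?tensDl ?tensZl ?tensDr ?tensZr.
have bc (q : P) : balanced (fun (m : M) (n : N) => tens m (tens n q : tensor N P)).
  move=> h m' n' hH; rewrite tens_balanced //; congr (tens _ _).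
  exact: tens_laE.
rewrite /assoc blift_tens.
- by rewrite blift_tens.
- split=> [q|t] a u v; first by rewrite linearP.
  by apply: blift_lin => m' n'; rewrite tensDr tensZr tensDr tensZr.
- move=> h t q hH /=; rewrite -!comp_lfunE.
  move: t; apply: tens_ext_v => m' n'; rewrite comp_lfunE (tens_raE _ _ hH).
  by rewrite !blift_tens // tens_balanced.
Qed.

Lemma assocVE (M N P : gbimod) (m : M) (n : N) (p : P) :
  assocV M N P (tens m (tens n p : tensor N P)) = tens (tens m n : tensor M N) p.
Proof.
have bb (q : M) : bilin (fun (n : N) (p : P) => tens (tens q n : tensor M N) p).
  by split=> [n'|m'] a u v; rewrite ?tensDl ?tensZl ?tensDr ?tensZr ?tensDl ?tensZl.
have bc (q : M) : balanced (fun (n : N) (p : P) => tens (tens q n : tensor M N) p).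
  move=> h m' n' hH; rewrite -tens_balanced //; congr (tens _ _).
  exact/esym/tens_raE.
rewrite /assocV blift_tens.
- by rewrite blift_tens.
- split=> [q|t] a u v; last by rewrite linearP.
  by apply: blift_lin => m' n'; rewrite !tensDl !tensZl.
- move=> h q t hH /=; rewrite -!comp_lfunE.
  move: t; apply: tens_ext_v => m' n'; rewrite comp_lfunE (tens_laE _ _ hH).
  by rewrite !blift_tens // tens_balanced.
Qed.

Lemma lunitE (M : gbimod) (a : gunit) (m : M) :
  lunit M (tens a m) = \sum_(h : subg_of H) ucoef a h *: gla (val h) m.
Proof.
rewrite /lunit blift_tens //.
  split=> [m'|b] c u v; rewrite scaler_sumr -big_split; apply: eq_bigr => h _ /=.
    by rewrite /ucoef !ffunE scalerDl scalerA.
  by rewrite linearP scalerDr !scalerA mulrC.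
move=> k b m' kH /=; rewrite (reindex_inj (mulIg (subg H k))).
apply: eq_bigr => h _; rewrite /ucoef unit_raE mulgK /= subgK //.
by rewrite glaM // subgP.
Qed.

Lemma runitVE (M : gbimod) (m : M) : runitV M m = tens m uone.
Proof. by rewrite linfunE_lin // => a u v; rewrite tensDl tensZl. Qed.

Lemma evE (M : gbimod) (phi : dual M) (m : M) :
  ev M (tens phi m)
  = [ffun k : subg_of H => (phi : 'Hom(M, F^o)) (gra (val k)^-1%g m)] :> ucar.
Proof.
rewrite /ev blift_tens //.
  split=> [m'|psi] c u v; apply/ffunP => k; rewrite !ffunE.
    by rewrite add_lfunE scale_lfunE.
  by rewrite !linearP.
move=> k psi m' kH; apply/ffunP => h; rewrite !ffunE /= pullbackE glra //.
by rewrite groupV subgP.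
Qed.

Lemma dbE (M : gbimod) (a : gunit) :
  db M a = \sum_(h : subg_of H) ucoef a h *: gla (val h) (casimir M).
Proof.
rewrite linfunE_lin // => c u v; rewrite scaler_sumr -big_split.
by apply: eq_bigr => h _ /=; rewrite /ucoef !ffunE scalerDl scalerA.
Qed.


Lemma homs_id (M : gbimod) : \1%VF \in homs M M.
Proof. by apply/homsP; split=> *; rewrite !id_lfunE. Qed.

Lemma homs_comp (M N P : gbimod) (g : 'Hom(N, P)) (f : 'Hom(M, N)) :
  g \in homs N P -> f \in homs M N -> (g \o f)%VF \in homs M P.
Proof.
move=> /homsP[gp gl gr] /homsP[fp fl fr]; apply/homsP.
by split=> *; rewrite !comp_lfunE ?fp ?fl ?fr ?gp ?gl ?gr.
Qed.

Lemma homs_tens (M N X : gbimod) (f : 'Hom(tensor M N, X)) :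
    (forall x m n, f (tens_pr M N x (tens m n)) = gpr x (f (tens m n))) ->
    (forall h m n, h \in H -> f (tens (gla h m) n) = gla h (f (tens m n))) ->
    (forall k m n, k \in H -> f (tens m (gra k n)) = gra k (f (tens m n))) ->
  f \in homs (tensor M N) X.
Proof.
move=> fp fl fr; apply/homsP; split=> [x v | h v hH | k v kH];
  rewrite -!comp_lfunE; move: v; apply: tens_ext_v => m n; rewrite !comp_lfunE.
- exact: fp.
- by rewrite [gla h (tens m n)]tens_laE // fl.
- by rewrite [gra k (tens m n)]tens_raE // fr.
Qed.

Lemma homs_tensm (M M' N N' : gbimod) (f : 'Hom(M, M')) (g : 'Hom(N, N')) :
  f \in homs M M' -> g \in homs N N' ->
  tensm f g \in homs (tensor M N) (tensor M' N').
Proof.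
move=> fH gH; have [fp fl fr] := homsP _ fH; have [gp gl gr] := homsP _ gH.
apply: homs_tens => [x m n | h m n hH | k m n kH].
- rewrite tens_prE linear_sum /= tensmE // [RHS]tens_prE.
  by apply: eq_bigr => y _; rewrite tensmE // fp gp.
- by rewrite !tensmE // fl // [RHS]tens_laE.
- by rewrite !tensmE // gr // [RHS]tens_raE.
Qed.

Lemma gpr_tens (M N : gbimod) x (m : M) (n : N) :
  gpr x (tens m n : tensor M N) = \sum_y tens (gpr y m) (gpr (y^-1 * x)%g n).
Proof. exact: tens_prE. Qed.
Lemma gla_tens (M N : gbimod) h (m : M) (n : N) :
  h \in H -> gla h (tens m n : tensor M N) = tens (gla h m) n.
Proof. exact: tens_laE. Qed.
Lemma gra_tens (M N : gbimod) h (m : M) (n : N) :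
  h \in H -> gra h (tens m n : tensor M N) = tens m (gra h n).
Proof. exact: tens_raE. Qed.

Lemma homs_ev (M : gbimod) : ev M \in homs (tensor (dual M) M) gunit.
Proof.
apply: homs_tens => [x phi m | h phi m hH | k phi m kH].
- apply/ffunP => k; rewrite tens_prE linear_sum /= sum_ffunE unit_prE evE ffunE.
  transitivity (\sum_(y : gT) if val k == x then
      (phi : 'Hom(M, F^o)) (gpr y^-1%g (gra (val k)^-1%g m)) else 0).
    apply: eq_bigr => y _; rewrite evE ffunE /= pullbackE.
    rewrite gra_pr ?groupV ?subgP // gprM.
    rewrite -mulgA -[X in X == _]mulg1 (inj_eq (mulgI _)) eq_sym -eq_mulgV1 eq_sym.
    by case: ifP; rewrite ?linear0.
  case: ifP => _; last by rewrite big1.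
  rewrite -linear_sum (reindex_inj invg_inj) /=.
  by under eq_bigr do rewrite invgK; rewrite gpr_sum.
- apply/ffunP => k; rewrite unit_laE !evE !ffunE /= pullbackE.
  by rewrite -graM ?groupV ?subgP // subgK // invMg invgK.
- apply/ffunP => h; rewrite unit_raE !evE !ffunE /=.
  by rewrite -graM ?groupV ?subgP // subgK // invMg invgK.
Qed.

Lemma casimir_ex (M : vectType F) (X : vectType F) (b : M -> 'Hom(M, F^o) -> X) (f g : 'End(M)) :
  bilin b ->
  \sum_i b (f (stdb i)) (pullback g (linfun (crd i : M -> F^o))) =
  \sum_i b (f (g (stdb i))) (linfun (crd i : M -> F^o)).
Proof.
case=> bl br.
transitivity (\sum_i \sum_(j : 'I_(\dim {:M})) crd i (g (stdb j)) *:
    b (f (stdb i)) (linfun (crd j : M -> F^o))).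
  apply: eq_bigr => i _; rewrite -(lin_sum (br _)); congr (b _ _).
  apply/lfunP => v; rewrite pullbackE sum_lfunE.
  rewrite (linfunE_lin (@crd_linear _ M i)) {1}(stdb_crd v).
  have lg : linear (fun v => crd i (g v) : F^o).
    by move=> a u w; rewrite linearP crd_linear.
  rewrite (lin_sum lg); apply: eq_bigr => j _.
  by rewrite scale_lfunE (linfunE_lin (@crd_linear _ M j)) /GRing.scale /= mulrC.
rewrite exchange_big /=; apply: eq_bigr => j _.
rewrite -(lin_sum (bl _)); congr (b _ _).
rewrite {2}(stdb_crd (g (stdb j))) linear_sum /=.
by apply: eq_bigr => i _; rewrite linearZ.
Qed.


Definition dcrd (M : gbimod) (i : 'I_(\dim {:M})) : dual M := linfun (crd i : M -> F^o).

Lemma dcrdE (M : gbimod) i (m : M) : (dcrd i : 'Hom(M, F^o)) m = crd i m.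
Proof. exact: (linfunE_lin (@crd_linear _ M i)). Qed.

Lemma gla_casimir (M : gbimod) h : h \in H -> gla h (casimir M) = gra h (casimir M).
Proof.
move=> hH; rewrite /casimir !linearZ !linear_sum /=; congr (_ *: _).
transitivity (\sum_i tens (\1%VF (gla h (stdb i : M))) (dcrd i)).
  by apply: eq_bigr => i _; rewrite gla_tens // id_lfunE.
rewrite -(casimir_ex \1 (gla h) (tens_bilin M (dual M))).
by apply: eq_bigr => i _; rewrite gra_tens // id_lfunE.
Qed.

Lemma gpr_casimir (M : gbimod) x :
  gpr x (casimir M) = if x == 1%g then casimir M else 0.
Proof.
transitivity (#|H|%:R^-1 *: \sum_(y : gT) \sum_i
    tens (gpr y (gpr (x^-1 * y)%g (stdb i : M))) (dcrd i)).
  rewrite linearZ linear_sum /=; congr (_ *: _).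
  under eq_bigr do rewrite gpr_tens.
  rewrite exchange_big; apply: eq_bigr => y _ /=.
  rewrite -(casimir_ex (gpr y) (gpr (x^-1 * y)%g) (tens_bilin M (dual M))).
  by apply: eq_bigr => i _; rewrite /= /dual_pr invMg invgK.
case: eqP => [->|/eqP x1].
  rewrite /casimir exchange_big; congr (_ *: _); apply: eq_bigr => i _ /=.
  rewrite -tens_suml -[in RHS](gpr_sum (stdb i)); congr (tens _ _).
  by apply: eq_bigr => y _; rewrite invg1 mul1g gprM eqxx.
rewrite big1 ?scaler0 // => y _; rewrite big1 // => i _.
rewrite gprM -[X in X == _]mul1g (inj_eq (mulIg _)) eq_sym invg_eq1 (negPf x1).
exact: tens0l.
Qed.

Lemma homs_db (M : gbimod) : db M \in homs gunit (tensor M (dual M)).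
Proof.
apply/homsP; split=> [x a | k a kH | k a kH]; rewrite !dbE linear_sum /=.
- apply: eq_bigr => h _; rewrite [RHS]linearZ /=.
  have -> : x = (val h * ((val h)^-1 * x))%g by rewrite mulKVg.
  rewrite -gla_pr ?subgP // gpr_casimir /ucoef unit_prE.
  rewrite -eq_mulVg1 mulKVg; case: eqP => // _.
  by rewrite linear0 scaler0 scale0r.
- rewrite (reindex_inj (mulgI (subg H k))); apply: eq_bigr => h _ /=.
  rewrite /ucoef unit_laE mulKg [RHS]linearZ /=.
  by rewrite subgK // glaM // subgP.
- rewrite (reindex_inj (mulIg (subg H k))); apply: eq_bigr => h _ /=.
  rewrite /ucoef unit_raE mulgK [RHS]linearZ /=.
  by rewrite subgK // glaM ?subgP // gla_casimir // glra ?subgP.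
Qed.

Lemma tens_ext3l (M N P : gbimod) (X : vectType F)
    (f g : 'Hom(tensor (tensor M N) P, X)) :
  (forall m n p, f (tens (tens m n : tensor M N) p) = g (tens (tens m n) p)) ->
  f =1 g.
Proof.
move=> fg v; have -> // : f = g.
apply: tens_ext => t p.
have lt : linear (fun t : tensor M N => tens t p).
  by move=> a u w; rewrite tensDl tensZl.
rewrite -(linfunE_lin lt) -!comp_lfunE; move: t; apply: tens_ext_v => m n.
by rewrite !comp_lfunE (linfunE_lin lt).
Qed.

Lemma tens_ext3r (M N P : gbimod) (X : vectType F)
    (f g : 'Hom(tensor M (tensor N P), X)) :
  (forall m n p, f (tens m (tens n p : tensor N P)) = g (tens m (tens n p))) ->
  f =1 g.
Proof.
move=> fg v; have -> // : f = g.
apply: tens_ext => m t.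
have lt : linear (fun t : tensor N P => tens m t).
  by move=> a u w; rewrite tensDr tensZr.
rewrite -(linfunE_lin lt) -!comp_lfunE; move: t; apply: tens_ext_v => n p.
by rewrite !comp_lfunE (linfunE_lin lt).
Qed.

Lemma assocK (M N P : gbimod) : cancel (assoc M N P) (assocV M N P).
Proof.
move=> v; rewrite -comp_lfunE -[RHS]id_lfunE; move: v.
by apply: tens_ext3l => m n p; rewrite comp_lfunE assocE assocVE id_lfunE.
Qed.

Lemma assocVK (M N P : gbimod) : cancel (assocV M N P) (assoc M N P).
Proof.
move=> v; rewrite -comp_lfunE -[RHS]id_lfunE; move: v.
by apply: tens_ext3r => m n p; rewrite comp_lfunE assocVE assocE id_lfunE.
Qed.

Lemma homs_assoc (M N P : gbimod) :
  assoc M N P \in homs (tensor (tensor M N) P) (tensor M (tensor N P)).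
Proof.
apply/homsP; split=> [x v | h v hH | k v kH];
  rewrite -!comp_lfunE; move: v; apply: tens_ext3l => m n p; rewrite !comp_lfunE.
- rewrite assocE !gpr_tens linear_sum /=.
  under [RHS]eq_bigr do rewrite gpr_tens tens_sumr.
  under eq_bigr do rewrite gpr_tens tens_suml linear_sum /=.
  rewrite exchange_big; apply: eq_bigr => z _ /=.
  rewrite (reindex_inj (mulgI z)); apply: eq_bigr => w _ /=.
  by rewrite assocE mulKg invMg mulgA.
- by rewrite assocE !gla_tens // assocE.
- by rewrite assocE !gra_tens // assocE.
Qed.

Lemma homs_assocV (M N P : gbimod) :
  assocV M N P \in homs (tensor M (tensor N P)) (tensor (tensor M N) P).
Proof.
have [ap al ar] := homsP _ (homs_assoc M N P).
apply/homsP; split=> [x v | h v hH | k v kH]; apply: (can_inj (@assocK M N P)).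
- exact: etrans (assocVK _)
    (etrans (congr1 (gpr x) (esym (assocVK v))) (esym (ap x _))).
- exact: etrans (assocVK _)
    (etrans (congr1 (gla h) (esym (assocVK v))) (esym (al h _ hH))).
- exact: etrans (assocVK _)
    (etrans (congr1 (gra k) (esym (assocVK v))) (esym (ar k _ kH))).
Qed.

Lemma uoneE h : ucoef uone h = (h == 1%g)%:R. Proof. by rewrite /ucoef ffunE. Qed.

Lemma lunit1 (M : gbimod) (m : M) : lunit M (tens uone m) = m.
Proof.
rewrite lunitE (bigD1 1%g) //= big1 ?addr0 => [|h h1].
  by rewrite uoneE eqxx scale1r gla1.
by rewrite uoneE (negPf h1) scale0r.
Qed.

Lemma unit_exp (a : gunit) : a = \sum_(h : subg_of H) ucoef a h *: gra (val h) uone.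
Proof.
apply/ffunP => z; rewrite sum_ffunE (bigD1 z) //= big1 ?addr0 => [|h hz].
  rewrite ffunE unit_raE sgvalK mulgV ffunE eqxx.
  by rewrite /GRing.scale /= mulr1.
rewrite ffunE unit_raE sgvalK ffunE -eq_mulgV1 eq_sym (negPf hz).
by rewrite /GRing.scale /= mulr0.
Qed.

Lemma gla_uone h : h \in H -> gla h uone = gra h uone.
Proof.
move=> hH; apply/ffunP => z; rewrite unit_laE unit_raE !ffunE.
by rewrite -eq_mulVg1 -eq_mulgV1 eq_sym.
Qed.

Lemma homs_lunit (M : gbimod) : lunit M \in homs (tensor gunit M) M.
Proof.
apply: homs_tens => [x a m | h a m hH | k a m kH].
- rewrite tens_prE linear_sum /=.
  under eq_bigr do rewrite lunitE.
  rewrite exchange_big lunitE linear_sum; apply: eq_bigr => h _ /=.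
  rewrite (bigD1 (val h)) //= big1 ?addr0 => [|y yh].
    by rewrite /ucoef unit_prE eqxx linearZ /= gla_pr ?subgP // mulKVg.
  by rewrite /ucoef unit_prE eq_sym (negPf yh) scale0r.
- rewrite !lunitE linear_sum (reindex_inj (mulgI (subg H h))) /=.
  apply: eq_bigr => k _; rewrite /ucoef unit_laE mulKg linearZ /= subgK //.
  by rewrite glaM ?subgP.
- rewrite !lunitE linear_sum; apply: eq_bigr => h _ /=.
  by rewrite linearZ /= glra ?subgP.
Qed.

Lemma homs_runitV (M : gbimod) : runitV M \in homs M (tensor M gunit).
Proof.
apply/homsP; split=> [x m | h m hH | k m kH]; rewrite !runitVE.
- rewrite gpr_tens (bigD1 x) //= big1 ?addr0 => [|y yx].
    rewrite mulVg; congr (tens _ _); apply/ffunP => z; rewrite unit_prE ffunE.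
    case: eqP => [->|z1]; first by rewrite eqxx.
    by case: eqP => // z1'; case: z1; apply: val_inj.
  have -> : gpr (y^-1 * x)%g uone = 0; last exact: tens0r.
  apply/ffunP => z; rewrite unit_prE !ffunE.
  case: eqP => // zx; case: eqP => // z1; case/eqP: yx.
  by apply/(mulgI (y^-1)%g); rewrite -zx z1 mulVg.
- by rewrite gla_tens.
- by rewrite gra_tens // -gla_uone // tens_balanced.
Qed.

Lemma evE_uone (M : gbimod) (phi : dual M) (m : M) :
  ev M (tens phi m) =
  \sum_(k : subg_of H) ((phi : 'Hom(M, F^o)) (gra (val k)^-1%g m) : F) *: gra (val k) uone.
Proof.
rewrite [LHS]unit_exp; apply: eq_bigr => k _.
by rewrite /ucoef evE ffunE.
Qed.

Lemma db1 (M : gbimod) : db M uone = casimir M.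
Proof.
rewrite dbE (bigD1 1%g) //= big1 ?addr0 => [|h h1].
  by rewrite uoneE eqxx scale1r gla1.
by rewrite uoneE (negPf h1) scale0r.
Qed.

Lemma card_subgT : #|subg_of H| = #|H|. Proof. by rewrite card_sub; apply: eq_card. Qed.

Lemma gla_casimirE (M : gbimod) h : h \in H ->
  gla h (casimir M) = #|H|%:R^-1 *: \sum_i tens (gla h (stdb i : M)) (dcrd i).
Proof.
move=> hH; rewrite /casimir linearZ linear_sum /=; congr (_ *: _).
by apply: eq_bigr => i _; rewrite gla_tens.
Qed.

Lemma casimirE (M : gbimod) :
  casimir M = #|H|%:R^-1 *: \sum_i tens (stdb i : M) (dcrd i).
Proof. by []. Qed.

Lemma snakeL_aux (M : gbimod) h (m : M) : #|H|%:R != 0 :> F -> h \in H ->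
  tensm \1 (ev M) (assoc M (dual M) M (tens (gla h (casimir M)) m))
  = runitV M (gla h m).
Proof.
move=> nzH hH.
rewrite gla_casimirE // tensZl tens_suml runitVE !linearZ !linear_sum /=.
transitivity (#|H|%:R^-1 *: \sum_i \sum_(k : subg_of H)
    tens (crd i (gra (val k)^-1%g m) *: gra (val k) (gla h (stdb i : M))) uone).
  congr (_ *: _); apply: eq_bigr => i _.
  rewrite assocE tensmE ?homs_id ?homs_ev // id_lfunE evE_uone tens_sumr.
  apply: eq_bigr => k _; rewrite dcrdE tensZr tensZl -gla_uone ?subgP //.
  by rewrite tens_balanced ?subgP.
rewrite exchange_big /= (eq_bigr (fun _ => tens (gla h m) uone)) => [|k _].
  by rewrite sumr_const card_subgT -scaler_nat scalerA mulVf ?scale1r.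
rewrite -tens_suml; congr (tens _ _).
transitivity (gra (val k) (gla h (gra (val k)^-1%g m))).
  rewrite [in RHS](stdb_crd (gra (val k)^-1%g m)) !linear_sum.
  by apply: eq_bigr => i _; rewrite !linearZ.
by rewrite -!glra ?subgP // -graM ?groupV ?subgP // mulVg gra1.
Qed.

Lemma snakeL (M : gbimod) : #|H|%:R != 0 :> F ->
  (tensm \1 (ev M) \o assoc M (dual M) M \o tensm (db M) \1)%VF
  = (runitV M \o lunit M)%VF.
Proof.
move=> nzH; apply: tens_ext => a m; rewrite !comp_lfunE.
rewrite tensmE ?homs_db ?homs_id // id_lfunE dbE tens_suml 2!linear_sum /=.
rewrite lunitE linear_sum; apply: eq_bigr => h _ /=.
rewrite tensZl [assoc _ _ _ _]linearZ [LHS]linearZ [RHS]linearZ; congr (_ *: _).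
by apply: snakeL_aux => //; apply: subgP.
Qed.

Lemma snakeR (M : gbimod) : #|H|%:R != 0 :> F ->
  (lunit (dual M) \o tensm (ev M) \1 \o assocV (dual M) M (dual M)
     \o tensm \1 (db M) \o runitV (dual M))%VF = \1%VF.
Proof.
move=> nzH; apply/lfunP => phi; rewrite !comp_lfunE id_lfunE runitVE.
rewrite tensmE ?homs_db ?homs_id // id_lfunE db1 casimirE.
rewrite tensZr tens_sumr !linearZ !linear_sum /=.
transitivity (#|H|%:R^-1 *: \sum_(i < \dim {:M}) \sum_(k : subg_of H)
    ((phi : 'Hom(M, F^o)) (gra (val k)^-1%g (stdb i)) : F) *: gla (val k) (dcrd i)).
  congr (_ *: _); apply: eq_bigr => i _.
  rewrite assocVE tensmE ?homs_id ?homs_ev // id_lfunE lunitE.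
  by apply: eq_bigr => k _; rewrite /ucoef evE ffunE.
rewrite exchange_big /= (eq_bigr (fun _ => phi)) => [|k _].
  by rewrite sumr_const card_subgT -scaler_nat scalerA mulVf ?scale1r.
apply/lfunP => m; rewrite sum_lfunE.
transitivity ((phi : 'Hom(M, F^o)) (gra (val k)^-1%g (gra (val k) m))).
  rewrite (stdb_crd (gra (val k) m)) !linear_sum; apply: eq_bigr => i _.
  by rewrite scale_lfunE !linearZ /= pullbackE dcrdE /GRing.scale /= mulrC.
by rewrite -graM ?groupV ?subgP // mulgV gra1.
Qed.

(* The transpose of a morphism f is [pullback f]: it satisfies [ev_pullback]. *)
Lemma homs_pullback (M N : gbimod) (f : 'Hom(M, N)) :
  f \in homs M N -> pullback f \in homs (dual N) (dual M).
Proof.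
move=> /homsP[fp fl fr]; apply/homsP.
by split=> *; apply/lfunP => m; rewrite !pullbackE ?fp ?fl ?fr.
Qed.

Lemma ev_pullback (M N : gbimod) (f : 'Hom(M, N)) (phi : dual N) (m : M) :
  f \in homs M N -> ev M (tens (pullback f phi : dual M) m) = ev N (tens phi (f m)).
Proof.
move=> /homsP[_ _ fr]; apply/ffunP => k.
by rewrite !evE !ffunE pullbackE fr ?groupV ?subgP.
Qed.

(* The nested evaluation W^* (x) V^* (x) V (x) W -> I. *)
Definition dpair (V W : gbimod) :
    'Hom(tensor (tensor (dual W) (dual V)) (tensor V W), gunit) :=
  (ev W
   \o tensm \1 (lunit W \o tensm (ev V) \1 \o assocV (dual V) V W)
   \o assoc (dual W) (dual V) (tensor V W))%VF.

(* The canonical isomorphism W^* (x) V^* -> (V (x) W)^*, whose characteristic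
   property is [ev_dtens]. *)
Definition dtens (V W : gbimod) :
    'Hom(tensor (dual W) (dual V), dual (tensor V W)) :=
  linfun (fun t => linfun (fun x : tensor V W =>
    ucoef (dpair V W (tens t x)) 1%g : F^o) : dual (tensor V W)).

Lemma homs_dpair (V W : gbimod) : dpair V W \in
  homs (tensor (tensor (dual W) (dual V)) (tensor V W)) gunit.
Proof.
apply: homs_comp; last exact: homs_assoc.
apply: homs_comp; first exact: homs_ev.
apply: homs_tensm; first exact: homs_id.
apply: homs_comp; last exact: homs_assocV.
apply: homs_comp; first exact: homs_lunit.
by apply: homs_tensm; [exact: homs_ev | exact: homs_id].
Qed.

Lemma dtensE (V W : gbimod) (t : tensor (dual W) (dual V)) (x : tensor V W) :
  (dtens V W t : 'Hom(tensor V W, F^o)) x = ucoef (dpair V W (tens t x)) 1%g.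
Proof.
have lx t' : linear (fun x : tensor V W =>
    ucoef (dpair V W (tens t' x)) 1%g : F^o).
  by move=> a u v; rewrite tensDr tensZr linearP /ucoef !ffunE.
rewrite linfunE_lin ?(linfunE_lin (lx t)) // => a u v.
apply/lfunP => y; rewrite add_lfunE scale_lfunE !(linfunE_lin (lx _)).
by rewrite tensDl tensZl linearP /ucoef !ffunE.
Qed.

Lemma ev_dtens (V W : gbimod) (t : tensor (dual W) (dual V)) (x : tensor V W) :
  ev (tensor V W) (tens (dtens V W t : dual (tensor V W)) x) = dpair V W (tens t x).
Proof.
have [_ _ pr] := homsP _ (homs_dpair V W).
apply/ffunP => k; rewrite evE ffunE dtensE -gra_tens ?groupV ?subgP //.
rewrite pr ?groupV ?subgP // /ucoef unit_raE mul1g.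
by rewrite morphV ?subgP //= sgvalK invgK.
Qed.


Lemma dpairE (V W : gbimod) (psi : dual W) (phi : dual V) v w :
  dpair V W (tens (tens psi phi : tensor (dual W) (dual V)) (tens v w : tensor V W))
  = ev W (tens psi (lunit W (tens (ev V (tens phi v)) w))).
Proof.
have evH := homs_tensm (homs_ev V) (homs_id W).
have lH := homs_comp (homs_comp (homs_lunit W) evH) (homs_assocV (dual V) V W).
rewrite comp_lfunE assocE comp_lfunE (tensmE _ _ (homs_id (dual W)) lH).
by rewrite id_lfunE !comp_lfunE assocVE (tensmE _ _ (homs_ev V) (homs_id W)) id_lfunE.
Qed.

Lemma dtens_pure (V W : gbimod) (psi : dual W) (phi : dual V) v w :
  (dtens V W (tens psi phi) : 'Hom(tensor V W, F^o)) (tens v w)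
  = \sum_(k : subg_of H) (phi : 'Hom(V, F^o)) (gra (val k)^-1%g v)
       * (psi : 'Hom(W, F^o)) (gla (val k) w).
Proof.
rewrite dtensE dpairE /ucoef evE ffunE /= invg1 gra1 lunitE linear_sum.
by apply: eq_bigr => k _; rewrite linearZ /= /ucoef evE ffunE.
Qed.

(* A pivotal structure: a monoidal natural isomorphism from the identity to the
   double dual. *)
Structure pivotal := Pivotal {
  piv :> forall V : gbimod, 'Hom(V, dual (dual V));
  piv_hom : forall V, piv V \in homs V (dual (dual V));
  piv_bij : forall V, bijective (piv V);
  piv_nat : forall (V W : gbimod) (f : 'Hom(V, W)), f \in homs V W ->
    (piv W \o f = pullback (pullback f) \o piv V)%VF;
  piv_tens : forall V W : gbimod,
    (pullback (dtens V W) \o piv (tensor V W)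
     = dtens (dual W) (dual V) \o tensm (piv V) (piv W))%VF
}.

Definition bidual (V : gbimod) : 'Hom(V, dual (dual V)) :=
  linfun (fun v : V => linfun (fun phi : 'Hom(V, F^o) => phi v) : dual (dual V)).

Lemma bidualE (V : gbimod) (v : V) (phi : dual V) :
  (bidual V v : 'Hom(dual V, F^o)) phi = (phi : 'Hom(V, F^o)) v.
Proof.
have lphi (u : V) : linear (fun phi : 'Hom(V, F^o) => phi u).
  by move=> a phi1 phi2; rewrite add_lfunE scale_lfunE.
rewrite linfunE_lin ?(linfunE_lin (lphi v)) // => a u w.
apply/lfunP => psi; rewrite add_lfunE scale_lfunE !(linfunE_lin (lphi _)).
by rewrite linearP.
Qed.

Lemma bidual_hom V : bidual V \in homs V (dual (dual V)).
Proof.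
apply/homsP; split=> [x v | h v hH | k v kH]; apply/lfunP => phi.
all: by rewrite bidualE pullbackE bidualE pullbackE ?invgK.
Qed.

Lemma bidual_bij V : bijective (bidual V).
Proof.
pose g (xi : dual (dual V)) : V :=
  \sum_i ((xi : 'Hom(dual V, F^o)) (dcrd i) : F) *: stdb i.
have gE (xi : dual (dual V)) (phi : dual V) :
    (phi : 'Hom(V, F^o)) (g xi) = (xi : 'Hom(dual V, F^o)) phi.
  have -> : phi = \sum_i ((phi : 'Hom(V, F^o)) (stdb i) : F) *: dcrd i.
    apply/lfunP => v; rewrite sum_lfunE [in LHS](stdb_crd v) linear_sum.
    by apply: eq_bigr => i _; rewrite linearZ scale_lfunE dcrdE /GRing.scale /= mulrC.
  rewrite [RHS]linear_sum sum_lfunE; apply: eq_bigr => i _.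
  rewrite scale_lfunE [RHS]linearZ dcrdE; congr (_ *: _).
  rewrite /g (lin_sum (@crd_linear _ V i)) (bigD1 i) //= crd_stdb eqxx.
  rewrite big1 ?addr0 => [|j /negPf ji]; first by rewrite /GRing.scale /= mulr1.
  by rewrite crd_stdb eq_sym ji scaler0.
exists g => [v | xi]; last by apply/lfunP => phi; rewrite bidualE gE.
apply/eqP; rewrite -subr_eq0; apply/eqP.
rewrite (stdb_crd (g _ - v)) big1 // => i _.
by rewrite -dcrdE linearB /= gE bidualE subrr scale0r.
Qed.

Lemma bidual_nat (V W : gbimod) (f : 'Hom(V, W)) : f \in homs V W ->
  (bidual W \o f = pullback (pullback f) \o bidual V)%VF.
Proof.
move=> _; apply/lfunP => v; rewrite !comp_lfunE; apply/lfunP => phi.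
by rewrite bidualE pullbackE bidualE pullbackE.
Qed.

Lemma bidual_tens V W :
  (pullback (dtens V W) \o bidual (tensor V W)
   = dtens (dual W) (dual V) \o tensm (bidual V) (bidual W))%VF.
Proof.
apply: tens_ext => v w; rewrite !comp_lfunE tensmE ?bidual_hom //.
apply: tens_ext => psi phi; rewrite pullbackE bidualE dtens_pure dtens_pure.
rewrite (reindex_inj invg_inj); apply: eq_bigr => k _ /=.
rewrite !bidualE /= !pullbackE invgK mulrC.
by [].
Qed.

Definition bidual_pivotal : pivotal :=
  Pivotal bidual_hom bidual_bij bidual_nat bidual_tens.


Lemma stdb_cyclic (V : vectType F) (f g : 'End(V)) :
  \sum_i crd i (f (g (stdb i))) = \sum_i crd i (g (f (stdb i))).
Proof.
have bb : bilin (fun (v : V) (phi : 'Hom(V, F^o)) => phi v).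
  split=> [phi | v] a u w; first by rewrite linearP.
  by rewrite add_lfunE scale_lfunE.
have := casimir_ex f g bb.
under eq_bigr => i _ do rewrite pullbackE (linfunE_lin (@crd_linear _ V i)).
move=> E; rewrite [RHS]E; apply: eq_bigr => i _.
by rewrite (linfunE_lin (@crd_linear _ V i)).
Qed.

Lemma trace_gla (V : gbimod) h : h \in H ->
  \sum_i crd i (gla h (stdb i : V)) = if h == 1%g then (\dim {:V})%:R else 0.
Proof.
move=> hH; case: eqP => [->|/eqP h1].
  rewrite (eq_bigr (fun _ => 1)) => [|i _]; last by rewrite gla1 crd_stdb eqxx.
  by rewrite sumr_const card_ord.
transitivity (\sum_i \sum_x crd i ((gpr (h * x)%g \o (gla h \o gpr x))%VF (stdb i : V)) : F).
  apply: eq_bigr => i _; rewrite -{1}(gpr_sum (stdb i)) !linear_sum.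
  rewrite {1}/crd linear_sum.
  by apply: eq_bigr => x _; rewrite !comp_lfunE /= gla_pr // gprM eqxx.
rewrite exchange_big big1 // => x _ /=.
rewrite (eq_bigr _ (fun i _ => congr1 (crd i) (comp_lfunE _ _ _))) stdb_cyclic big1 // => i _.
rewrite !comp_lfunE gprM -[X in X == _]mul1g (inj_eq (mulIg _)) eq_sym (negPf h1).
by rewrite linear0 /crd linear0.
Qed.

Lemma bidual_dim (V : gbimod) :
  (ev (dual V) \o tensm (bidual V) \1 \o db V)%VF
  = ((\dim {:V})%:R / #|H|%:R) *: \1%VF.
Proof.
set f := (X in X = _).
have fH : f \in homs gunit gunit.
  apply: homs_comp; last exact: homs_db.
  apply: homs_comp; first exact: homs_ev.
  by apply: homs_tensm; [exact: bidual_hom | exact: homs_id].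
have [_ _ fr] := homsP _ fH.
suff f1 : f uone = ((\dim {:V})%:R / #|H|%:R) *: uone.
  apply/lfunP => a; rewrite scale_lfunE id_lfunE (unit_exp a) linear_sum scaler_sumr.
  apply: eq_bigr => h _; rewrite linearZ /= fr ?subgP // f1.
  by rewrite [gra _ _]linearZ !scalerA mulrC.
rewrite /f !comp_lfunE db1 casimirE !linearZ !linear_sum /= mulrC -scalerA.
congr (_ *: _); apply/ffunP => k; rewrite sum_ffunE.
transitivity (\sum_i crd i (gla (val k)^-1%g (stdb i : V))).
  apply: eq_bigr => i _; rewrite tensmE ?bidual_hom ?homs_id // id_lfunE.
  by rewrite evE ffunE bidualE pullbackE dcrdE.
rewrite trace_gla ?groupV ?subgP // !ffunE invg_eq1 -(inj_eq val_inj) /=.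
by case: eqP => _; rewrite /GRing.scale /= ?mulr1 ?mulr0.
Qed.

Fixpoint tpow (V : gbimod) (k : nat) : gbimod :=
  if k is k'.+1 then tensor V (tpow V k') else gunit.

(* The reassociation V^k (x) V -> V (x) V^k. *)
Fixpoint rot (V : gbimod) (k : nat) :
    'Hom(tensor (tpow V k) V, tensor V (tpow V k)) :=
  match k return 'Hom(tensor (tpow V k) V, tensor V (tpow V k)) with
  | 0 => (runitV V \o lunit V)%VF
  | k'.+1 => (tensm \1 (rot V k') \o assoc V (tpow V k') V)%VF
  end.

(* The endomorphism E_V^(m) of Hom(I, V^m), for m = k + 1. *)
Definition rotE (j : pivotal) (V : gbimod) (k : nat)
    (f : 'Hom(gunit, tpow V k.+1)) : 'Hom(gunit, tpow V k.+1) :=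
  let X := tpow V k in
  (rot V k
   \o tensm \1 (j V)^-1
   \o tensm (lunit X \o tensm (ev V) \1) \1
   \o tensm (assocV (dual V) V X) \1
   \o tensm (tensm \1 f) \1
   \o tensm (runitV (dual V)) \1
   \o db (dual V))%VF.

(* The trace of the restriction to U of a linear map stabilizing U; for [rotE] this
   stability is [homs_rotE]. *)
Definition trv (X : vectType F) (U : {vspace X}) (f : X -> X) : F :=
  \sum_(i < \dim U) coord (vbasis U) i (f (vbasis U)`_i).

(* Only m >= 1 is meaningful. *)
Definition nu (j : pivotal) (m : nat) (V : gbimod) : F :=
  if m is k.+1 then trv (homs gunit (tpow V k.+1)) (@rotE j V k) else 0.

Lemma homs_rot V k : rot V k \in homs (tensor (tpow V k) V) (tensor V (tpow V k)).
Proof.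
elim: k => [|k IH]; first by apply: homs_comp; [exact: homs_runitV | exact: homs_lunit].
by apply: homs_comp; [apply: homs_tensm => //; exact: homs_id | exact: homs_assoc].
Qed.

Lemma piv_invK (j : pivotal) V : cancel (j V)^-1%VF (j V).
Proof.
move=> w; apply: limg_lfunVK.
have [g gK Kg] := piv_bij j V.
by apply/memv_imgP; exists (g w); rewrite ?memvf ?Kg.
Qed.

Lemma homs_pivV (j : pivotal) V : (j V)^-1%VF \in homs (dual (dual V)) V.
Proof.
have [jp jl jr] := homsP _ (piv_hom j V); have jI := bij_inj (piv_bij j V).
by apply/homsP; split=> *; apply: jI; rewrite ?jp ?jl ?jr ?piv_invK.
Qed.

Lemma homs_rotE j V k f :
  f \in homs gunit (tpow V k.+1) -> @rotE j V k f \in homs gunit (tpow V k.+1).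
Proof.
move=> fH; rewrite /rotE.
apply: homs_comp; last exact: homs_db.
apply: homs_comp; last by apply: homs_tensm; [exact: homs_runitV | exact: homs_id].
apply: homs_comp; last first.
  by apply: homs_tensm; [apply: homs_tensm => //|]; exact: homs_id.
apply: homs_comp; last by apply: homs_tensm; [exact: homs_assocV | exact: homs_id].
apply: homs_comp; last first.
  apply: homs_tensm; last exact: homs_id.
  apply: homs_comp; first exact: homs_lunit.
  by apply: homs_tensm; [exact: homs_ev | exact: homs_id].
apply: homs_comp; first exact: homs_rot.
by apply: homs_tensm; [exact: homs_id | exact: homs_pivV].
Qed.

Definition iso (M N : gbimod) :=
  exists f : 'Hom(M, N), exists g : 'Hom(N, M),
    [/\ f \in homs M N, g \in homs N M, cancel f g & cancel g f].

Definition subobject (V : gbimod) (U : {vspace V}) :=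
  [/\ forall x v, v \in U -> gpr x v \in U,
      forall h v, h \in H -> v \in U -> gla h v \in U
    & forall k v, k \in H -> v \in U -> gra k v \in U].

Definition simple (V : gbimod) :=
  {:V}%VS <> 0%VS /\
  forall U : {vspace V}, subobject U -> U = 0%VS \/ U = {:V}%VS.

(* Y lists the simple objects, each once up to isomorphism. *)
Definition simple_family (n : nat) (Y : 'I_n -> gbimod) :=
  [/\ forall i, simple (Y i), forall i i', iso (Y i) (Y i') -> i = i'
    & forall V, simple V -> exists i, iso V (Y i)].

(* Left multiplication by X in the Grothendieck ring: the multiplicity of the simple
   object Y_i in X (x) Y_i' is the dimension of Hom(Y_i, X (x) Y_i'). *)
Definition fusion_mx (n : nat) (Y : 'I_n -> gbimod) (X : gbimod) : 'M[F]_n :=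
  \matrix_(i, i') (\dim (homs (Y i) (tensor X (Y i'))))%:R.

Section Fibre.
Variables (d : gT) (M : gbimod).

(* d H d^-1 is H :^ d^-1, as A :^ x denotes x^-1 A x. *)
Definition stab : {group gT} := (H :&: H :^ d^-1)%G.

(* M_{dH}, and below its subspace spanned by the m k - m, the quotient
   (M_{dH})/H and the action of s on it. *)
Definition fibre : {vspace M} := (\sum_(x in (d *: H)%g) limg (gpr x))%VS.

Definition fibre_rel : {vspace subvs_of fibre} :=
  (\sum_(k in H) limg (linfun (fun u : subvs_of fibre =>
     vsproj fibre (gra k (vsval u) - vsval u))))%VS.

Definition fibreq : vectType F := quotv fibre_rel.

Definition fibreq_act (s : gT) : 'End(fibreq) :=
  linfun (fun q : fibreq =>
    qproj fibre_rel (vsproj fibre (gla s (vsval (qsec fibre_rel q))))).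

(* M represents F_d(W): it lies in the subcategory supported on H d H, and the
   functor M |-> (M_{dH})/H sends it to a representation isomorphic to W, the space
   of column vectors on which s acts by rW s.  This determines M up to isomorphism. *)
Definition is_Fd (n : nat) (rW : mx_representation F stab n) :=
  (forall x (v : M), x \notin ((H :* d) * H)%g -> gpr x v = 0) /\
  exists phi : 'Hom(fibreq, 'cV[F]_n), bijective phi /\
    forall s q, s \in stab -> phi (fibreq_act s q) = rW s *m phi q.

End Fibre.

End Bimodules.

Section Canonical.
Variables (C : numClosedFieldType) (gT : finGroupType) (H : {group gT}).

(* The largest nonnegative eigenvalue of left multiplication by X. *)
Definition is_FPdim (X : gbimod C H) (l : C) :=
  exists n (Y : 'I_n -> gbimod C H), simple_family Y /\
  [/\ 0 <= l, eigenvalue (fusion_mx Y X) l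
    & forall l', 0 <= l' -> eigenvalue (fusion_mx Y X) l' -> l' <= l].

(* The composite below is the endomorphism of the unit object given by the pivotal
   dimension of V. *)
Definition canonical_pivotal (j : pivotal C H) :=
  forall V : gbimod C H, simple V -> exists2 l : C, is_FPdim V l
    & (ev (dual V) \o tensm (j V) \1 \o db V = l *: \1)%VF.
End Canonical.

Section Groups.
Variables (gT : finGroupType) (H : {group gT}) (d : gT).

(* E = C_G(d) /\ S C_G(S) /\ N_G(H), with S the stabilizer of dH in H. *)
Definition Eset : {set gT} :=
  ('C[d] :&: (stab H d * 'C(stab H d)) :&: 'N(H))%g.

(* T is a set of representatives of the orbits [orb x] that make up X. *)
Definition orbit_reps (orb : gT -> {set gT}) (X T : {set gT}) :=
  T \subset X /\ forall x, x \in X -> #|T :&: orb x| = 1%N.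

Definition conj_orbit (S' : {group gT}) (r : gT) : {set gT} :=
  [set (s * r * s^-1)%g | s in S'].
Definition tconj_orbit (S' : {group gT}) (h : gT) : {set gT} :=
  [set (d^-1 * s * d * h * s^-1)%g | s in S'].
End Groups.

(* Main.v *)
Require Import Defs.
From mathcomp Require Import all_boot all_order all_algebra all_fingroup.
From mathcomp Require Import mxrepresentation.
From mathcomp Require Import spectral.
From Stdlib Require Import Classical.
From mathcomp Require Import complex reals.

Set Implicit Arguments.
Unset Strict Implicit.
Unset Printing Implicit Defensive.

Import GRing.Theory Num.Theory.
Local Open Scope ring_scope.

(** Let S be the stabilizer of dH in H.

    The canonical pivotal structure is the evaluation map of vector spaces. Any pivotal
    structure j differs from that map by a natural monoidal automorphism of the
    identity functor ([pivdef]). On a simple object U it is a scalar c, and comparing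
    the pivotal dimension, which is a nonnegative Frobenius-Perron dimension, with
    c dim U / |H| gives c > 0. The scalar of a simple constituent of U^{(x) k} is c^k
    by naturality and monoidality; since there are only finitely many simple objects,
    two different powers of c coincide, so c = 1 ([canonical_simple]). By Maschke's
    theorem the automorphism is then trivial on every object ([canonical_bidual]).

    For this pivotal structure the indicator is a trace on the whole tensor power
    T = V^{(x) m} over CH. A morphism I -> T is an element of T of degree 1 on which
    the two actions of H agree, and in these terms E_V^{(m)} becomes the map
    v (x) x |-> 1/|H| sum_h hx (x) v h^-1. On all of degree 1 this map takes values in
    such elements, so its trace on them is its trace on the degree 1 part ([nu_ltr]).
    Taking the partial trace over one tensor factor after the other ([sweepE]) yields
      nu_m(V) = 1/|H| sum_{r^m in H} tr (v |-> r^-m v r^m on V_r)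
    for every object V ([nu_deg_trace]).

    The summand is invariant under conjugation of r by H and vanishes off HdH when V is
    F_d(W), so that the sum may be restricted to r in dH, with |S| in place of |H|
    ([double_coset_sum]). For such r each class of (M_{dH})/H has a unique representative
    of degree r, and v |-> s v s^-1 corresponds on classes to the action of s; hence the
    trace is eta(r^-m), the conjugate of eta(r^m) ([deg_trace_repr], [trace_reprV]).

    Finally an element se of SE maps dH to itself by conjugation, normalizes S, and acts
    on S like an inner automorphism because E lies in S C_G(S); so the summand is constant
    on S'-orbits, whose sizes are |S'| / |S' /\ C_G(r)| ([orbit_reps_sum]). Multiplication
    by d turns twisted conjugation on H into conjugation on dH
    ([orbit_reps_lcoset]). *)

(** * Traces and dual families *)

Section Trace.
Variable F : fieldType.
Implicit Types V W X : vectType F.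

Definition ltr V (f : V -> V) : F := \sum_i crd i (f (stdb i)).

Definition crdf V (i : 'I_(\dim {:V})) : 'Hom(V, F^o) := linfun (crd i : V -> F^o).

Lemma crdfE V (i : 'I_(\dim {:V})) v : crdf i v = crd i v.
Proof. exact: (linfunE_lin (@crd_linear _ V i)). Qed.

Lemma crd_sum V (i : 'I_(\dim {:V})) I (r : seq I) (P : pred I) (c : I -> F) (v : I -> V) :
  crd i (\sum_(k <- r | P k) c k *: v k) = \sum_(k <- r | P k) c k * crd i (v k).
Proof. exact: (lin_sum (@crd_linear _ V i)). Qed.

Lemma crd_sumr V (i : 'I_(\dim {:V})) I (r : seq I) (P : pred I) (v : I -> V) :
  crd i (\sum_(k <- r | P k) v k) = \sum_(k <- r | P k) crd i (v k).
Proof.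
have := crd_sum i r P (fun=> 1) v.
by under eq_bigr do rewrite scale1r; under [RHS]eq_bigr do rewrite mul1r.
Qed.

Lemma crdZ V (i : 'I_(\dim {:V})) a (v : V) : crd i (a *: v) = a * crd i v.
Proof. by rewrite /crd linearZ. Qed.

Lemma eq_ltr V (f g : V -> V) : f =1 g -> ltr f = ltr g.
Proof. by move=> fg; apply: eq_bigr => i _; rewrite fg. Qed.

Lemma ltr_sum V I (r : seq I) (P : pred I) (f : I -> V -> V) :
  ltr (fun v => \sum_(k <- r | P k) f k v) = \sum_(k <- r | P k) ltr (f k).
Proof. by rewrite exchange_big; apply: eq_bigr => i _; apply: crd_sumr. Qed.

Lemma ltrZ V a (f : V -> V) : ltr (fun v => a *: f v) = a * ltr f.
Proof. by rewrite /ltr mulr_sumr; apply: eq_bigr => i _; apply: crdZ. Qed.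

Lemma ltr0 V : ltr (fun _ : V => 0) = 0.
Proof. by rewrite /ltr big1 // => i _; rewrite /crd linear0. Qed.

(** A family [x] with forms [xi] such that [v = \sum_i xi_i(v) x_i] represents the
    identity of V in [V^* (x) V], exactly as the standard basis and its coordinates
    do; hence both give the same value to every bilinear expression. *)
Lemma dual_family V X (I : finType) (x : I -> V) (xi : I -> 'Hom(V, F^o))
    (b : 'Hom(V, F^o) -> V -> X) :
  bilin b -> (forall v, \sum_i (xi i v : F) *: x i = v) ->
  \sum_i b (xi i) (x i) = \sum_i b (crdf i) (stdb i).
Proof.
case=> bl br xiE.
transitivity (\sum_i \sum_j crd j (x i) *: b (xi i) (stdb j)).
  by apply: eq_bigr => i _; rewrite {1}(stdb_crd (x i)) (lin_sum (br _)).
rewrite exchange_big; apply: eq_bigr => j _ /=.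
rewrite -(lin_sum (bl _)); congr (b _ _); apply/lfunP => v.
rewrite sum_lfunE crdfE -[in RHS](xiE v) crd_sum.
by apply: eq_bigr => i _; rewrite scale_lfunE /GRing.scale /= mulrC.
Qed.

Lemma ltr_family V (I : finType) (x : I -> V) (xi : I -> 'Hom(V, F^o)) (f : V -> V) :
  linear f -> (forall v, \sum_i (xi i v : F) *: x i = v) ->
  ltr f = \sum_i (xi i (f (x i)) : F).
Proof.
move=> lf xiE; pose b (phi : 'Hom(V, F^o)) v := phi (f v).
have bb : bilin b.
  split=> [n | m] a u v; rewrite /b; first by rewrite add_lfunE scale_lfunE.
  by rewrite lf linearP.
by rewrite [RHS](dual_family bb xiE); apply: eq_bigr => i _; rewrite /b crdfE.
Qed.

Lemma ltr_comm V W (f : V -> W) (g : W -> V) : linear f -> linear g ->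
  ltr (fun v => g (f v)) = ltr (fun w => f (g w)).
Proof.
move=> lf lg.
transitivity (\sum_i \sum_j crd j (f (stdb i)) * crd i (g (stdb j))).
  apply: eq_bigr => i _; rewrite {1}(stdb_crd (f (stdb i))) (lin_sum lg).
  exact: crd_sum.
rewrite exchange_big; apply: eq_bigr => j _ /=.
rewrite {2}(stdb_crd (g (stdb j))) (lin_sum lf) crd_sum.
by apply: eq_bigr => i _; rewrite mulrC.
Qed.

(** Cyclicity of the trace, for e : V -> U and the restriction of p to U. *)
Lemma trv_ltr V X (U : {vspace X}) (p : X -> V) (e : V -> X) (f : X -> X) :
  linear p -> linear e -> (forall v, e v \in U) ->
  (forall u, u \in U -> f u = e (p u)) -> trv U f = ltr (fun v => p (e v)).
Proof.
move=> lp le eU fE.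
transitivity (\sum_(i < \dim U) \sum_j
    crd j (p (vbasis U)`_i) * coord (vbasis U) i (e (stdb j))).
  apply: eq_bigr => i _; rewrite fE ?vbasis_mem ?mem_nth ?size_tuple //.
  rewrite {1}(stdb_crd (p _)) (lin_sum le) linear_sum.
  by apply: eq_bigr => j _; rewrite linearZ.
rewrite exchange_big; apply: eq_bigr => j _ /=.
rewrite [in RHS](coord_vbasis (eU (stdb j))) (lin_sum lp) crd_sum.
by apply: eq_bigr => i _; rewrite mulrC.
Qed.

Lemma ltr_mx n (A : 'M[F]_n) : ltr (fun w : 'cV[F]_n => A *m w) = \tr A.
Proof.
pose xi i : 'Hom('cV[F]_n, F^o) := linfun (fun w : 'cV[F]_n => w i 0 : F^o).
have xiE i w : xi i w = w i 0.
  by rewrite linfunE_lin // => a u v; rewrite !mxE.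
rewrite (@ltr_family _ _ (fun i => delta_mx i 0) xi).
- apply: eq_bigr => i _; rewrite xiE !mxE (bigD1 i) //= big1 ?addr0.
    by rewrite mxE !eqxx mulr1.
  by move=> j /negPf ji; rewrite mxE ji mulr0.
- by move=> a u v; rewrite linearP.
move=> w; apply/colP => k; rewrite summxE (bigD1 k) //= big1 ?addr0.
  by rewrite !mxE xiE !eqxx mulr1.
by move=> j; rewrite eq_sym => /negPf jk; rewrite !mxE jk mulr0.
Qed.

End Trace.

(** * The indicator as a trace *)

Section Indicator.
Variables (F : fieldType) (gT : finGroupType) (H : {group gT}).
Hypothesis nzH : #|H|%:R != 0 :> F.
Local Notation gbimod := (gbimod F H).
Local Notation gpr := (@gpr F gT H _).
Local Notation gla := (@gla F gT H _).
Local Notation gra := (@gra F gT H _).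
Local Notation gunit := (gunit F H).
Local Notation uone := (uone F H).
Local Notation rot := (@Defs.rot F gT H).

Lemma avg_const (X : lmodType F) (x : X) : #|H|%:R^-1 *: (\sum_(h in H) x) = x.
Proof. by rewrite sumr_const -scaler_nat scalerA mulVf ?scale1r. Qed.

(** The contraction of V (x)_H X against a linear form xi on X: v (x) x |-> xi(x) v is
    not balanced, its average over H is. *)
Definition contr_fun (V X : gbimod) (xi : 'Hom(X, F^o)) (v : V) (x : X) : V :=
  #|H|%:R^-1 *: \sum_(h in H) (xi (gla h x) : F) *: gra h^-1%g v.
Definition contr (V X : gbimod) (xi : 'Hom(X, F^o)) : 'Hom(tensor V X, V) :=
  blift (contr_fun xi).

Lemma bilin_contr_fun (V X : gbimod) xi : bilin (@contr_fun V X xi).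
Proof.
apply: (@bilin_comp F gT H V X _ _ ( *:%R #|H|%:R^-1)) => [a u w|].
  by rewrite scalerDr !scalerA mulrC.
apply: (@bilin_sum F gT H V X) => h; split=> [x | v] a u w.
  by rewrite linearP scalerDr !scalerA mulrC.
by rewrite !linearP scalerDl scalerA.
Qed.

Lemma contrE (V X : gbimod) xi (v : V) (x : X) :
  contr V xi (tens v x) = #|H|%:R^-1 *: \sum_(h in H) (xi (gla h x) : F) *: gra h^-1%g v.
Proof.
apply: blift_tens; first exact: bilin_contr_fun.
move=> k m n kH; rewrite /contr_fun; congr (_ *: _).
rewrite (reindex_inj (mulIg k)) /=; apply: eq_big => [h | h hkH]; first by rewrite groupMr.
have hH : h \in H by rewrite -(groupMr h kH).
by rewrite invMg glaM // -graM ?groupM ?groupV // mulKVg.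
Qed.

(** Moving h across the tensor sign undoes the average in [contr]. As a consequence the
    stdb_i (x) stdb_j, although in general linearly dependent, and the forms
    crd_i o contr crd_j are dual families of V (x)_H X; with them traces on V (x)_H X can
    be computed without a basis. *)
Lemma contr_family (V X : gbimod) (t : tensor V X) :
  \sum_j tens (contr V (crdf j) t) (stdb j : X) = t.
Proof.
have lt j : linear (fun t : tensor V X => tens (contr V (crdf j) t) (stdb j : X)).
  by move=> a u w; rewrite linearP tensDl tensZl.
rewrite -[RHS]id_lfunE.
under eq_bigr do rewrite -(linfunE_lin (lt _)).
rewrite -sum_lfunE; move: t; apply: tens_ext_v => v x.
rewrite sum_lfunE id_lfunE.
under eq_bigr do rewrite (linfunE_lin (lt _)) contrE tensZl tens_suml.
rewrite -scaler_sumr exchange_big /= -[RHS]avg_const; congr (_ *: _).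
apply: eq_bigr => h hH.
rewrite -[in RHS](gra1 v) -(mulVg h) graM ?groupV // tens_balanced //.
rewrite [in RHS](stdb_crd (gla h x)) tens_sumr.
by apply: eq_bigr => j _; rewrite tensZl tensZr crdfE.
Qed.

Lemma contr_family_pair (V X : gbimod) (t : tensor V X) :
  \sum_(p : 'I_(\dim {:V}) * 'I_(\dim {:X}))
    (crd p.1 (contr V (crdf p.2) t) : F) *: tens (stdb p.1 : V) (stdb p.2 : X) = t.
Proof.
rewrite -[RHS]contr_family -(pair_bigA _ (fun i j => (crd i (contr V (crdf j) t) : F) *:
   tens (stdb i : V) (stdb j : X))) exchange_big; apply: eq_bigr => j _ /=.
rewrite [in RHS](stdb_crd (contr V (crdf j) t)) tens_suml.
by apply: eq_bigr => i _; rewrite tensZl.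
Qed.

Lemma ltr_tens (V X : gbimod) (A : tensor V X -> tensor V X) : linear A ->
  ltr A = \sum_i \sum_j crd i (contr V (crdf j) (A (tens (stdb i) (stdb j)))).
Proof.
move=> lA; rewrite pair_bigA /=.
pose xi (p : 'I_(\dim {:V}) * 'I_(\dim {:X})) : 'Hom(tensor V X, F^o) :=
  (crdf p.1 \o contr V (crdf p.2))%VF.
rewrite (@ltr_family _ _ _ (fun p => tens (stdb p.1 : V) (stdb p.2 : X)) xi) //.
  by apply: eq_bigr => p _; rewrite comp_lfunE crdfE.
move=> t; rewrite -[RHS]contr_family_pair; apply: eq_bigr => p _.
by rewrite comp_lfunE crdfE.
Qed.

Lemma contr_gla (V X : gbimod) xi h (t : tensor V X) : h \in H ->
  contr V xi (gla h t) = gla h (contr V xi t).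
Proof.
move=> hH; rewrite -!comp_lfunE; move: t; apply: tens_ext_v => v x.
rewrite !comp_lfunE gla_tens // !contrE [RHS]linearZ; congr (_ *: _); rewrite linear_sum.
by apply: eq_bigr => k kH; rewrite linearZ /= glra ?groupV.
Qed.

Lemma contr_lin (V X : gbimod) (t : tensor V X) :
  linear (fun xi : 'Hom(X, F^o) => contr V xi t).
Proof.
move=> a xi1 xi2; apply: blift_lin => v x; rewrite /contr_fun.
rewrite scalerA mulrC -scalerA -scalerDr; congr (_ *: _).
rewrite scaler_sumr -big_split.
by apply: eq_bigr => h _ /=; rewrite add_lfunE scale_lfunE scalerDl scalerA.
Qed.

Lemma gpr_gpr (V : gbimod) x y (v : V) : gpr x (gpr y v) = if x == y then gpr y v else 0.
Proof. by rewrite gprM; case: eqP => // ->. Qed.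

Lemma gpr_bimul (V : gbimod) z a b g (v : V) : a \in H -> b \in H ->
  gpr z (gla a (gra b (gpr g v))) =
  if z == (a * g * b)%g then gla a (gra b (gpr g v)) else 0.
Proof. by move=> aH bH; rewrite gra_pr // gla_pr // gpr_gpr mulgA. Qed.

(** The partial trace over V^{(x) k} of the reassociation
    V^{(x) k} (x) V -> V (x) V^{(x) k}, on the tensors whose first k factors have total
    degree y. *)
Definition sweep (V : gbimod) k y (v : V) : V :=
  \sum_j contr V (crdf j) (rot V k (tens (gpr y (stdb j : tpow V k)) v)).

Lemma sweep_family (V : gbimod) k y (v : V) (I : finType) (x : I -> tpow V k)
    (xi : I -> 'Hom(tpow V k, F^o)) :
  (forall t, \sum_i (xi i t : F) *: x i = t) ->
  sweep k y v = \sum_i contr V (xi i) (rot V k (tens (gpr y (x i)) v)).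
Proof.
move=> xiE.
pose b (phi : 'Hom(tpow V k, F^o)) t := contr V phi (rot V k (tens (gpr y t) v)).
have bb : bilin b.
  split=> [t | phi]; first exact: contr_lin.
  by move=> a t u; rewrite /b linearP tensDl tensZl !linearP.
exact/esym/(dual_family bb xiE).
Qed.

Definition uform (g : subg_of H) : 'Hom(gunit, F^o) :=
  linfun (fun a : gunit => ucoef a g : F^o).

Lemma uformE g a : uform g a = ucoef a g.
Proof. by rewrite linfunE_lin // => c u v; rewrite /ucoef !ffunE. Qed.

Lemma sweep0 (V : gbimod) y (v : V) :
  sweep 0 y v
  = #|H|%:R^-1 *: \sum_(g : subg_of H)
      if val g == y then gla (val g) (gra (val g)^-1%g v) else 0.
Proof.
rewrite (sweep_family (k := 0) y v (x := fun g => gra (val g) uone) (xi := uform)); last first.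
  by move=> t; rewrite [RHS]unit_exp; apply: eq_bigr => g _; rewrite uformE.
rewrite scaler_sumr; apply: eq_bigr => g _.
have degg : gpr y (gra (val g) uone) = if val g == y then gra (val g) uone else 0.
  apply/ffunP => z; rewrite unit_prE.
  case: (eqVneq (val g) y) => gy; rewrite unit_raE ?ffunE; last first.
    case: eqP => // zy; rewrite /= sgvalK -eq_mulgV1; case: eqP => // zg.
    by case/eqP: gy; rewrite -zg.
  rewrite /= sgvalK -eq_mulgV1; case: (eqVneq z g) => [->|]; first by rewrite gy eqxx.
  by case: ifP.
rewrite degg; case: eqP => _; last by rewrite tens0l !linear0 ?scaler0.
rewrite /= comp_lfunE [tens (gra _ _) _]tens_balanced ?subgP // lunit1 runitVE.
rewrite contrE; congr (_ *: _).
rewrite (bigD1 (val g)) ?subgP //= big1 ?addr0 => [|h /andP[hH hg]].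
  rewrite uformE -[RHS]scale1r glra ?groupV ?subgP //; congr (_ *: _).
  by rewrite /ucoef unit_laE sgvalK mulVg ffunE eqxx.
rewrite uformE /ucoef unit_laE ffunE -eq_mulVg1.
case: eqP => [hg'|_]; last by rewrite scale0r.
by case/eqP: hg; rewrite -hg' subgK.
Qed.

Lemma rotSE (V : gbimod) k (m v : V) (x : tpow V k) :
  rot V k.+1 (tens (tens m x : tpow V k.+1) v) = tens m (rot V k (tens x v)).
Proof.
by rewrite /= comp_lfunE assocE tensmE ?homs_id ?homs_rot // id_lfunE.
Qed.

(** Evaluate the partial trace over V (x) V^{(x) k} on the dual families of
    [contr_family_pair]; the sum over the factor V collapses. *)
Lemma sweepS (V : gbimod) k y (v : V) :
  sweep k.+1 y v
  = #|H|%:R^-1 *: \sum_(h in H) \sum_z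
      gra h^-1%g (gpr z (gla h (sweep k (z^-1 * y)%g v))).
Proof.
pose xi (p : 'I_(\dim {:V}) * 'I_(\dim {:tpow V k})) : 'Hom(tensor V (tpow V k), F^o) :=
  (crdf p.1 \o contr V (crdf p.2))%VF.
rewrite (sweep_family (k := k.+1) y v
  (x := fun p => tens (stdb p.1 : V) (stdb p.2 : tpow V k)) (xi := xi)); last first.
  move=> t; rewrite -[RHS]contr_family_pair; apply: eq_bigr => p _.
  by rewrite comp_lfunE crdfE.
transitivity (#|H|%:R^-1 *: \sum_p \sum_(h in H) \sum_z
   (crd p.1 (gla h (contr V (crdf p.2)
       (rot V k (tens (gpr (z^-1 * y)%g (stdb p.2 : tpow V k)) v)))) : F)
    *: gra h^-1%g (gpr z (stdb p.1 : V))).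
  rewrite scaler_sumr; apply: eq_bigr => p _.
  rewrite exchange_big scaler_sumr gpr_tens tens_suml !linear_sum.
  apply: eq_bigr => z _; apply: etrans (congr1 (contr V (xi p)) (rotSE _ _ _)) _.
  rewrite contrE; congr (_ *: _); apply: eq_bigr => h hH.
  by rewrite comp_lfunE crdfE contr_gla.
congr (_ *: _); rewrite exchange_big; apply: eq_bigr => h hH /=.
rewrite exchange_big; apply: eq_bigr => z _ /=.
set c := fun j => contr V (crdf j) (rot V k (tens (gpr (z^-1 * y)%g (stdb j : tpow V k)) v)).
rewrite -(pair_bigA _ (fun i j => (crd i (gla h (c j)) : F) *: gra h^-1%g (gpr z (stdb i : V)))).
rewrite exchange_big /sweep /= !linear_sum; apply: eq_bigr => j _ /=.
rewrite [in RHS](stdb_crd (gla h _)) !linear_sum.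
by apply: eq_bigr => i _; rewrite !linearZ.
Qed.

(** By [sweepS] each further factor multiplies the degree by that of v, conjugated in H.
    The elements of H that come from the averages, one for each factor, only matter
    through their product c. *)
Lemma sweepE (V : gbimod) k y (v : V) :
  sweep k y v
  = #|H|%:R^-1 *: \sum_(c in H) \sum_g
      if (c * g ^+ k)%g == y then gla c (gra c^-1%g (gpr g v)) else 0.
Proof.
elim: k y => [|k IH] y.
  rewrite sweep0; congr (_ *: _).
  transitivity (\sum_(c in H) if c == y then gla c (gra c^-1%g v) else 0).
    rewrite (reindex (fun g : subg_of H => val g)) /=.
      by apply: eq_bigl => g; rewrite subgP.
    exists (subg H) => [g _ | h hH]; first exact: sgvalK.
    by rewrite subgK.
  apply: eq_bigr => c _; under [RHS]eq_bigr do rewrite mulg1.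
  case: eqP => _; last by rewrite big1.
  by rewrite -!linear_sum gpr_sum.
rewrite sweepS; congr (_ *: _).
rewrite -[RHS]avg_const scaler_sumr; apply: eq_bigr => h hH.
under eq_bigr do rewrite IH !linearZ.
rewrite -scaler_sumr; congr (_ *: _).
rewrite [RHS](reindex_inj (mulgI h)) /=.
rewrite [RHS](eq_bigl (fun c => c \in H)); last by move=> c; rewrite groupMl.
under eq_bigr do rewrite !linear_sum.
rewrite exchange_big; apply: eq_bigr => c cH /=.
under eq_bigr do rewrite !linear_sum.
rewrite exchange_big; apply: eq_bigr => g _ /=.
(* the degree of h c v c^-1 when v has degree g *)
rewrite (bigD1 (h * c * g * c^-1)%g) //= big1 ?addr0 => [|z /negPf zE].
  have -> : ((c * g ^+ k)%g == ((h * c * g * c^-1)^-1 * y)%g)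
          = ((h * c * g ^+ k.+1)%g == y).
    rewrite -(inj_eq (mulgI (h * c * g * c^-1)%g)) mulKVg.
    by rewrite !mulgA mulgKV expgS mulgA.
  case: ifP => _; last by rewrite !linear0.
  rewrite -glaM // gpr_bimul ?groupM ?groupV // eqxx.
  by rewrite -glra ?groupM ?groupV // -graM ?groupV // invMg.
case: ifP => _; last by rewrite !linear0.
by rewrite -glaM // gpr_bimul ?groupM ?groupV // zE linear0.
Qed.

Lemma big_subg (X : nmodType) (E : gT -> X) :
  \sum_(g : subg_of H) E (val g) = \sum_(h in H) E h.
Proof.
rewrite [RHS](reindex (fun g : subg_of H => val g)) /=.
  by apply: eq_bigl => g; rewrite subgP.
by exists (subg H) => [g _ | h hH]; [exact: sgvalK | exact: subgK].
Qed.

(** The swap v (x) x |-> x (x) v does not descend to tensor products over CH, only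
    its average over H does. *)
Definition twist_fun (V X : gbimod) (v : V) (x : X) : tensor X V :=
  #|H|%:R^-1 *: \sum_(h in H) tens (gla h x) (gra h^-1%g v).
Definition twist (V X : gbimod) : 'Hom(tensor V X, tensor X V) :=
  blift (@twist_fun V X).

Lemma twistE (V X : gbimod) (v : V) (x : X) :
  twist V X (tens v x) = #|H|%:R^-1 *: \sum_(h in H) tens (gla h x) (gra h^-1%g v).
Proof.
apply: blift_tens.
  apply: (@bilin_comp F gT H V X _ _ ( *:%R #|H|%:R^-1)) => [a u w|].
    by rewrite scalerDr !scalerA mulrC.
  apply: (@bilin_sum F gT H V X) => h; split=> [y | w] a u u'.
    by rewrite linearP tensDr tensZr.
  by rewrite linearP tensDl tensZl.
move=> k m n kH; rewrite /twist_fun; congr (_ *: _).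
rewrite (reindex_inj (mulIg k)) /=; apply: eq_big => [h | h hkH]; first by rewrite groupMr.
have hH : h \in H by rewrite -(groupMr h kH).
by rewrite invMg glaM // -graM ?groupM ?groupV // mulKVg.
Qed.

Lemma twist_central (V X : gbimod) k (t : tensor V X) : k \in H ->
  gla k (twist V X t) = gra k (twist V X t).
Proof.
move=> kH; rewrite -!comp_lfunE; move: t; apply: tens_ext_v => v x.
rewrite !comp_lfunE twistE !linearZ; congr (_ *: _); rewrite !linear_sum /=.
rewrite [RHS](reindex_inj (mulgI k)) /=; apply: eq_big => [h | h hH].
  by rewrite groupMl.
rewrite gla_tens // gra_tens // -glaM // -graM ?groupV ?groupM //.
by rewrite invMg mulgKV.
Qed.

Lemma gpr_tens_hom (V X : gbimod) z a b (v : V) (x : X) :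
  gpr z (tens (gpr a v) (gpr b x) : tensor V X) =
  if z == (a * b)%g then tens (gpr a v) (gpr b x) else 0.
Proof.
rewrite gpr_tens (bigD1 a) //= big1 ?addr0 => [|y /negPf ya].
  rewrite !gpr_gpr eqxx; have -> : ((a^-1 * z)%g == b) = (z == (a * b)%g).
    by rewrite -(inj_eq (mulgI a)) mulKVg.
  by case: eqP => // _; rewrite tens0r.
by rewrite gpr_gpr ya tens0l.
Qed.

Lemma twist_deg1 (V X : gbimod) (t : tensor V X) :
  gpr 1%g (twist V X (gpr 1%g t)) = twist V X (gpr 1%g t).
Proof.
rewrite -!comp_lfunE; move: t; apply: tens_ext_v => v x.
rewrite !comp_lfunE gpr_tens !linear_sum; apply: eq_bigr => y _ /=.
rewrite mulg1 twistE linearZ; congr (_ *: _).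
rewrite linear_sum; apply: eq_bigr => h hH /=.
rewrite [gla _ _]gla_pr // [gra _ _]gra_pr ?groupV // gpr_tens_hom.
by rewrite !mulgA mulgKV mulgV eqxx.
Qed.

(** A morphism I -> X is the same as an element of X of degree 1 on which the two
    actions of H agree. *)
Lemma homs_point (X : gbimod) (t : X) :
  gpr 1%g t = t -> (forall h, h \in H -> gla h t = gra h t) ->
  linfun (fun a : gunit => lunit X (tens a t)) \in homs gunit X.
Proof.
move=> t1 tc; have lt : linear (fun a : gunit => lunit X (tens a t)).
  by move=> a u v; rewrite tensDl tensZl linearP.
have [lp ll lr] := homsP _ (homs_lunit X).
apply/homsP; split=> [x a | h a hH | h a hH]; rewrite !(linfunE_lin lt).
- rewrite -lp gpr_tens (bigD1 x) //= big1 ?addr0 ?mulVg ?t1 // => y yx.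
  rewrite -t1 gpr_gpr; case: eqP => [E|_]; last exact: tens0r.
  by case/eqP: yx; apply/eqP; rewrite eq_mulVg1 E.
- by rewrite -ll // gla_tens.
by rewrite -lr // gra_tens // -tc // tens_balanced.
Qed.

Lemma homs_gunit_inj (X : gbimod) f g : f \in homs gunit X -> g \in homs gunit X ->
  f uone = g uone -> f = g.
Proof.
move=> /homsP[_ _ fr] /homsP[_ _ gr] fg; apply/lfunP => a.
rewrite (unit_exp a) !linear_sum; apply: eq_bigr => h _.
by rewrite !linearZ /= fr ?subgP // gr ?subgP // fg.
Qed.

Section BidualPivot.
Variables (j : pivotal F H) (V : gbimod) (k : nat).
Hypothesis jV : piv j V = bidual V.
Local Notation X := (tpow V k).

Lemma piv_invE v : (j V)^-1%VF (bidual V v) = v.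
Proof. by apply: (bij_inj (piv_bij j V)); rewrite piv_invK jV. Qed.

(** The evaluation V^* (x) V -> CH contributes sum_h phi(v h^-1) h, and summing over the
    basis of V^* that comes from the coevaluation turns phi into v h^-1 in the last
    place. *)
Lemma rotE_uone (f : 'Hom(gunit, tpow V k.+1)) : f \in homs gunit (tpow V k.+1) ->
  rotE j f uone = rot V k (twist V X (f uone)).
Proof.
move=> fH.
have fTH := homs_tensm (homs_id (dual V)) fH.
have evH := homs_comp (homs_lunit X) (homs_tensm (homs_ev V) (homs_id X)).
rewrite /rotE !comp_lfunE; congr (rot V k _).
rewrite db1 casimirE !linearZ !linear_sum /=.
pose Bf (phi : dual V) (xi : dual (dual V)) (t : tensor V X) : tensor X V :=
  tens ((lunit X \o tensm (ev V) \1)%VF (assocV (dual V) V X (tens phi t)))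
       ((j V)^-1%VF xi).
transitivity (#|H|%:R^-1 *: \sum_i Bf (stdb i) (dcrd i) (f uone)).
  congr (_ *: _); apply: eq_bigr => i _.
  rewrite (tensmE _ _ (homs_runitV (dual V)) (homs_id _)) id_lfunE runitVE.
  rewrite (tensmE _ _ fTH (homs_id _)) id_lfunE.
  rewrite (tensmE _ _ (homs_id _) fH) id_lfunE.
  rewrite (tensmE _ _ (homs_assocV _ _ _) (homs_id _)) id_lfunE.
  rewrite (tensmE _ _ evH (homs_id _)) id_lfunE.
  by rewrite (tensmE _ _ (homs_id _) (homs_pivV j V)) id_lfunE.
move: (f uone) => t.
have lB : linear (fun t : tensor V X => #|H|%:R^-1 *: \sum_i Bf (stdb i) (dcrd i) t).
  move=> a u w; rewrite scalerA mulrC -scalerA -scalerDr; congr (_ *: _).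
  rewrite scaler_sumr -big_split; apply: eq_bigr => i _ /=.
  by rewrite /Bf tensDr tensZr !linearP tensDl tensZl.
rewrite -(linfunE_lin lB); move: t; apply: tens_ext_v => v x.
rewrite (linfunE_lin lB) twistE; congr (_ *: _).
transitivity (\sum_(i < \dim {:dual V}) \sum_(h : subg_of H)
   tens (gla (val h) x) ((((stdb i : dual V) : 'Hom(V, F^o)) (gra (val h)^-1%g v) : F)
                          *: (j V)^-1%VF (dcrd i))).
  apply: eq_bigr => i _; rewrite /Bf assocVE comp_lfunE.
  rewrite (tensmE _ _ (homs_ev V) (homs_id X)) id_lfunE lunitE tens_suml.
  by apply: eq_bigr => h _; rewrite /ucoef evE ffunE tensZl tensZr.
rewrite exchange_big -[RHS]big_subg; apply: eq_bigr => h _ /=.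
rewrite -tens_sumr; congr (tens _ _); rewrite -[RHS]piv_invE.
have -> : bidual V (gra (val h)^-1%g v) = \sum_(i < \dim {:dual V})
    (((stdb i : dual V) : 'Hom(V, F^o)) (gra (val h)^-1%g v) : F) *: dcrd i.
  apply/lfunP => phi; rewrite bidualE sum_lfunE {1}(stdb_crd phi) sum_lfunE.
  by apply: eq_bigr => i _; rewrite !scale_lfunE dcrdE /GRing.scale /= mulrC.
by rewrite linear_sum; apply: eq_bigr => i _; rewrite linearZ.
Qed.

(** The averaged rotation sends all elements of degree 1 to elements that define
    morphisms I -> T, so no trace is lost or gained by enlarging the space. *)
Lemma nu_ltr :
  nu j k.+1 V = ltr (fun t : tensor V X => rot V k (twist V X (gpr 1%g t))).
Proof.
set A := fun t : tensor V X => rot V k (twist V X (gpr 1%g t)).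
have lA : linear A by move=> a u v; rewrite /A !linearP.
have [rp rl rr] := homsP _ (homs_rot V k).
have A1 t : gpr 1%g (A t) = A t by rewrite /A -rp twist_deg1.
have Ac t h : h \in H -> gla h (A t) = gra h (A t).
  by move=> hH; rewrite /A -rl // twist_central // rr.
pose e t : 'Hom(gunit, tensor V X) := linfun (fun a : gunit => lunit _ (tens a (A t))).
have lAt t : linear (fun a : gunit => lunit _ (tens a (A t))).
  by move=> a u v; rewrite tensDl tensZl linearP.
have eH t : e t \in homs gunit (tpow V k.+1) by apply: homs_point; [exact: A1 | exact: Ac].
have e1 t : e t uone = A t by rewrite (linfunE_lin (lAt t)) lunit1.
rewrite /nu (@trv_ltr _ (tensor V X) _ (homs gunit (tpow V k.+1)) (fun f => f uone) e).
- by apply: eq_ltr => t; rewrite e1.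
- by move=> a u v; rewrite add_lfunE scale_lfunE.
- move=> a u v; apply/lfunP => b; rewrite add_lfunE scale_lfunE !(linfunE_lin (lAt _)).
  by rewrite lA tensDr tensZr linearP.
- exact: eH.
move=> f fH; apply: homs_gunit_inj; rewrite ?homs_rotE //.
have [fp _ _] := homsP _ fH.
rewrite rotE_uone // e1 /A -fp; congr (rot _ _ (twist _ _ (f _))).
apply/ffunP => z; rewrite unit_prE ffunE; case: (eqVneq z 1%g) => [->|z1].
  by rewrite eqxx.
by case: ifP.
Qed.

Lemma nu_sweep :
  nu j k.+1 V = #|H|%:R^-1 * \sum_y \sum_(h in H)
    ltr (fun v : V => gla h (sweep k y^-1%g (gra h^-1%g (gpr y v)))).
Proof.
rewrite nu_ltr ltr_tens; last by move=> a u v; rewrite !linearP.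
have [_ rl _] := homsP _ (homs_rot V k).
transitivity (\sum_(i < \dim {:V}) \sum_j \sum_y \sum_(h in H) #|H|%:R^-1 * crd i
    (gla h (contr V (crdf j) (rot V k
        (tens (gpr y^-1%g (stdb j : X)) (gra h^-1%g (gpr y (stdb i : V)))))))).
  apply: eq_bigr => i _; apply: eq_bigr => l _.
  rewrite gpr_tens !linear_sum crd_sumr; apply: eq_bigr => y _ /=.
  rewrite mulg1 twistE !linearZ crdZ -mulr_sumr; congr (_ * _).
  rewrite !linear_sum crd_sumr; apply: eq_bigr => h hH /=.
  by rewrite -gla_tens // rl // contr_gla.
rewrite mulr_sumr.
under eq_bigr do rewrite exchange_big.
rewrite exchange_big; apply: eq_bigr => y _ /=.
under eq_bigr do rewrite exchange_big.
rewrite exchange_big mulr_sumr; apply: eq_bigr => h hH /=.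
rewrite /ltr mulr_sumr; apply: eq_bigr => i _; rewrite -mulr_sumr; congr (_ * _).
by rewrite /sweep linear_sum crd_sumr.
Qed.

End BidualPivot.

(** The trace on V_r of v |-> a v a^-1, meaningful if a commutes with r. *)
Definition deg_trace (V : gbimod) r a : F :=
  ltr (fun v : V => gla a (gra a^-1%g (gpr r v))).

(** In [nu_sweep] and [sweepE] conjugate by h and collect the elements of H into one
    element a: the condition on the degrees becomes a r^m = 1. *)
Theorem nu_deg_trace (j : pivotal F H) (V : gbimod) m :
  piv j V = bidual V -> (0 < m)%N ->
  nu j m V = #|H|%:R^-1 * \sum_(r | (r ^+ m)%g \in H) deg_trace V r (r ^- m)%g.
Proof.
case: m => // k jV _; rewrite nu_sweep //; congr (_ * _).
transitivity (\sum_(h in H) #|H|%:R^-1 * \sum_r \sum_(a in H)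
   if (a * r ^+ k.+1 == 1)%g then deg_trace V r a else 0).
  rewrite exchange_big; apply: eq_bigr => h hH /=.
  (* r is conjugate in H to the degree y h^-1 of the vector that gets swept *)
  rewrite mulr_sumr (reindex_inj (mulgI h)); apply: eq_bigr => r _ /=.
  transitivity (#|H|%:R^-1 * \sum_(c in H)
     if (c * h * r ^+ k.+1 == 1)%g then deg_trace V r (c * h)%g else 0).
    transitivity (ltr (fun v : V => #|H|%:R^-1 *: \sum_(c in H)
      if (c * h * r ^+ k.+1 == 1)%g then
        gla h (gla c (gra c^-1%g (gra h^-1%g (gpr (h * r)%g v)))) else 0)).
      apply: eq_ltr => v; rewrite sweepE linearZ; congr (_ *: _).
      rewrite linear_sum; apply: eq_bigr => c cH /=.
      rewrite (bigD1 (h * r * h^-1)%g) //= big1 ?addr0 => [|g /negPf gE].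
        have -> : ((c * (h * r * h^-1) ^+ k)%g == ((h * r)^-1)%g)
          = (c * h * r ^+ k.+1 == 1)%g.
          rewrite -[in LHS](inj_eq (mulIg (h * r)%g)) mulVg.
          have -> : (h * r * h^-1 = r ^ h^-1)%g by rewrite conjgE invgK mulgA.
          by rewrite -conjXg conjgE invgK expgSr !mulgA mulgKV.
        case: ifP => _; last by rewrite linear0.
        by rewrite [gra h^-1%g _]gra_pr ?groupV // gpr_gpr eqxx.
      rewrite [gra h^-1%g _]gra_pr ?groupV // gpr_gpr gE.
      by case: ifP => _; rewrite ?linear0.
    rewrite ltrZ ltr_sum; congr (_ * _); apply: eq_bigr => c cH.
    case: ifP => _; last exact: ltr0.
    pose B (v : V) := gla c (gra c^-1%g (gra h^-1%g (gla h (gpr r v)))).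
    transitivity (ltr (fun v : V => gla h (B (gla h^-1%g v)))).
      apply: eq_ltr => v; rewrite /B.
      do 4![congr (Defs.gla _ _ _) | congr (Defs.gra _ _ _)].
      by rewrite gla_pr // -glaM ?groupV // mulgV gla1.
    rewrite (@ltr_comm _ V V (fun v => B (gla h^-1%g v)) (gla h)); first last.
    - by move=> a u v; rewrite linearP.
    - by move=> a u v; rewrite /B !linearP.
    apply: eq_ltr => v; rewrite -glaM ?groupV // mulVg gla1 /B.
    by rewrite -graM ?groupV // -invMg glaM // !glra ?groupV ?groupM.
  congr (_ * _); rewrite [RHS](reindex_inj (mulIg h)) /=.
  by apply: eq_bigl => c; rewrite groupMr.
rewrite -mulr_sumr -[RHS](avg_const (X := F^o)); congr (_ * _).
apply: eq_bigr => h _; rewrite [RHS]big_mkcond; apply: eq_bigr => r _.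
case: ifP => rH; last first.
  rewrite big1 // => a aH; case: eqP => // E.
  by move: rH; rewrite -(groupMl _ aH) E group1.
rewrite (bigD1 (r ^- k.+1)%g) ?groupV //= mulVg eqxx big1 ?addr0 // => a /andP[_ aE].
by rewrite -[(r ^+ k.+1)%g]invgK -eq_mulgV1 (negPf aE).
Qed.

End Indicator.

(** * Pivotal structures and natural monoidal automorphisms *)

Section Pivotal.
Variables (F : fieldType) (gT : finGroupType) (H : {group gT}).
Hypothesis nzH : #|H|%:R != 0 :> F.
Variable j : pivotal F H.
Local Notation gbimod := (gbimod F H).
Local Notation gpr := (@gpr F gT H _).
Local Notation gla := (@gla F gT H _).
Local Notation gra := (@gra F gT H _).

(** The natural monoidal automorphism of the identity by which j differs from the
    evaluation map of vector spaces. *)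
Definition pivdef (V : gbimod) : 'End(V) := ((bidual V)^-1 \o piv j V)%VF.

Lemma bidual_pivdef (V : gbimod) v : bidual V (pivdef V v) = j V v.
Proof. by rewrite comp_lfunE; apply: (piv_invK (bidual_pivotal F H)). Qed.

Lemma bidual_inj (V : gbimod) : injective (bidual V).
Proof. exact: bij_inj (bidual_bij V). Qed.

Lemma pivdef_hom V : pivdef V \in homs V V.
Proof. exact: homs_comp (homs_pivV (bidual_pivotal F H) V) (piv_hom j V). Qed.

Lemma pivdef_nat (V W : gbimod) (f : 'Hom(V, W)) v : f \in homs V W ->
  pivdef W (f v) = f (pivdef V v).
Proof.
move=> fH; apply: bidual_inj; rewrite bidual_pivdef.
have bE u : bidual W (f u) = pullback (pullback f) (bidual V u).
  by have /lfunP/(_ u) := bidual_nat fH; rewrite !comp_lfunE.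
have jE u : j W (f u) = pullback (pullback f) (j V u).
  by have /lfunP/(_ u) := piv_nat j fH; rewrite !comp_lfunE.
by rewrite jE bE bidual_pivdef.
Qed.

Lemma dtens_contr (V W : gbimod) (psi : dual W) (phi : dual V) t :
  (dtens V W (tens psi phi) : 'Hom(tensor V W, F^o)) t =
  #|H|%:R * ((phi : 'Hom(V, F^o)) (contr V (psi : 'Hom(W, F^o)) t) : F).
Proof.
have lr : linear (fun t : tensor V W =>
    #|H|%:R * ((phi : 'Hom(V, F^o)) (contr V (psi : 'Hom(W, F^o)) t) : F) : F^o).
  by move=> a u v; rewrite !linearP mulrDr /GRing.scale /= mulrCA.
rewrite -[RHS](linfunE_lin lr); move: t; apply: tens_ext_v => v w.
rewrite (linfunE_lin lr) dtens_pure contrE linearZ /GRing.scale /= mulrA mulfV // mul1r.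
rewrite linear_sum -[RHS]big_subg; apply: eq_bigr => h _.
by rewrite linearZ /GRing.scale /= mulrC.
Qed.

(** By [dtens_contr] the forms psi (x) phi determine the coordinates of t on the dual
    families of [contr_family_pair]. *)
Lemma dtens_sep (V W : gbimod) (t t' : tensor V W) :
  (forall (psi : dual W) (phi : dual V),
     (dtens V W (tens psi phi) : 'Hom(tensor V W, F^o)) t
     = (dtens V W (tens psi phi) : 'Hom(tensor V W, F^o)) t') -> t = t'.
Proof.
move=> E; rewrite -(contr_family_pair nzH t) -(contr_family_pair nzH t').
apply: eq_bigr => p _; congr (_ *: _).
have := E (crdf p.2) (crdf p.1); rewrite !dtens_contr => /(mulfI nzH).
by rewrite !crdfE.
Qed.

(** The map j and the evaluation map satisfy the same compatibility with duals of tensor products;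
    comparing them takes the injectivity provided by [dtens_sep]. *)
Lemma pivdef_tens (V W : gbimod) v w :
  pivdef (tensor V W) (tens v w) = tens (pivdef V v) (pivdef W w).
Proof.
apply: dtens_sep => psi phi.
pose xi t := pullback (dtens V W) (bidual (tensor V W) t).
have xiE t : (dtens V W (tens psi phi) : 'Hom(tensor V W, F^o)) t = xi t (tens psi phi).
  by rewrite /xi pullbackE bidualE.
rewrite !xiE /xi bidual_pivdef; congr ((_ : 'Hom(_, F^o)) (tens psi phi)).
have jE : pullback (dtens V W) (j (tensor V W) (tens v w))
    = dtens (dual W) (dual V) (tens (j V v) (j W w)).
  have /lfunP/(_ (tens v w)) := piv_tens j V W.
  by rewrite !comp_lfunE tensmE ?piv_hom.
have bE v' w' : pullback (dtens V W) (bidual (tensor V W) (tens v' w'))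
    = dtens (dual W) (dual V) (tens (bidual V v') (bidual W w')).
  have /lfunP/(_ (tens v' w')) := bidual_tens V W.
  by rewrite !comp_lfunE tensmE ?bidual_hom.
by rewrite jE bE !bidual_pivdef.
Qed.

Definition nonzero (V : gbimod) := exists v : V, v != 0.

(** A tensor v (x) w with v homogeneous of degree x and both factors nonzero is
    nonzero: among the degrees x k^-1 of the v k^-1 only that for k = 1 is x, so a form
    supported in degree x isolates one term of [dtens_pure]. *)
Lemma nonzero_tensor V W : nonzero V -> nonzero W -> nonzero (tensor V W).
Proof.
move=> [v0 v0n] [w wn].
have crd_neq0 (X : vectType F) (x : X) : x != 0 -> exists i, crd i x != 0.
  move=> xn; apply/existsP; apply: contraR xn => /existsPn x0.
  rewrite (stdb_crd x) big1 // => i _; have := x0 i.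
  by rewrite negbK => /eqP ->; rewrite scale0r.
have [x vxn] : exists x, gpr x v0 != 0.
  apply/existsP; apply: contraR v0n => /existsPn x0.
  rewrite -(gpr_sum v0) big1 // => x _; have := x0 x.
  by rewrite negbK => /eqP ->.
have [i iv] := crd_neq0 _ _ vxn; have [k kw] := crd_neq0 _ _ wn.
exists (tens (gpr x v0) w).
apply: contraNneq (mulf_neq0 iv kw) => t0; apply/eqP.
transitivity ((dtens V W (tens (crdf k : dual W) ((crdf i \o gpr x)%VF : dual V))
   : 'Hom(tensor V W, F^o)) (tens (gpr x v0) w)); last by rewrite t0 linear0.
rewrite dtens_pure (bigD1 1%g) //= big1 ?addr0 => [|h h1].
  by rewrite invg1 gra1 gla1 comp_lfunE !crdfE gpr_gpr eqxx.
rewrite comp_lfunE gra_pr ?groupV ?subgP // gpr_gpr.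
case: eqP => [E|_]; last by rewrite linear0 mul0r.
case/eqP: h1; apply: val_inj; apply: invg_inj; apply: (mulgI x).
by rewrite -E /= invg1 mulg1.
Qed.

(** U^{(x) (k+1)}, without a trailing unit object. *)
Fixpoint tensor_power (U : gbimod) k : gbimod :=
  if k is k'.+1 then tensor U (tensor_power U k') else U.

Lemma nonzero_tensor_power U k : nonzero U -> nonzero (tensor_power U k).
Proof. by move=> nU; elim: k => [|k IH] //=; apply: nonzero_tensor. Qed.

Lemma pivdef_tensor_power U c k : (forall u, pivdef U u = c *: u) ->
  forall t, pivdef (tensor_power U k) t = c ^+ k.+1 *: t.
Proof.
move=> Uc; elim: k => [|k IH] t; first by rewrite expr1 Uc.
have lc : linear (fun t : tensor_power U k.+1 => c ^+ k.+2 *: t).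
  by move=> a u v; rewrite scalerDr !scalerA mulrC.
rewrite -(linfunE_lin lc); move: t; apply: tens_ext_v => u t.
by rewrite (linfunE_lin lc) pivdef_tens Uc IH tensZl tensZr scalerA -exprS.
Qed.

End Pivotal.

(** * Subobjects and complete reducibility *)

Section Subobjects.
Variables (F : fieldType) (gT : finGroupType) (H : {group gT}).
Hypothesis nzH : #|H|%:R != 0 :> F.
Local Notation gbimod := (gbimod F H).
Local Notation gpr := (@gpr F gT H _).
Local Notation gla := (@gla F gT H _).
Local Notation gra := (@gra F gT H _).

Section SubObject.
Variables (V : gbimod) (U : {vspace V}).
Hypothesis sU : subobject U.

(** Compressed to U with [vsproj], so that it makes sense for all f; it is the restriction
    of f when f stabilizes U, see [sub_endoE]. *)
Definition sub_endo (f : 'End(V)) : 'End(subvs_of U) :=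
  linfun (fun u : subvs_of U => vsproj U (f (vsval u))).

Lemma sub_endoE (f : 'End(V)) u :
  (forall v, v \in U -> f v \in U) -> vsval (sub_endo f u) = f (vsval u).
Proof.
move=> fU; rewrite linfunE_lin ?vsprojK ?fU ?subvsP // => a x y.
by rewrite !linearP.
Qed.

Lemma sub_prE x u : vsval (sub_endo (gpr x) u) = gpr x (vsval u).
Proof. by case: sU => Up _ _; apply: sub_endoE => v; apply: Up. Qed.
Lemma sub_laE h u : h \in H -> vsval (sub_endo (gla h) u) = gla h (vsval u).
Proof. by case: sU => _ Ul _ hH; apply: sub_endoE => v; apply: Ul. Qed.
Lemma sub_raE h u : h \in H -> vsval (sub_endo (gra h) u) = gra h (vsval u).
Proof. by case: sU => _ _ Ur hH; apply: sub_endoE => v; apply: Ur. Qed.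

Lemma sub_gprM x y u : sub_endo (gpr x) (sub_endo (gpr y) u)
  = if x == y then sub_endo (gpr x) u else 0.
Proof.
apply: val_inj; rewrite /= !sub_prE gprM.
by case: eqP => _; rewrite ?sub_prE //= linear0.
Qed.
Lemma sub_gpr_sum u : \sum_x sub_endo (gpr x) u = u.
Proof.
apply: val_inj; rewrite /= linear_sum -[RHS]gpr_sum.
by apply: eq_bigr => x _; rewrite /= sub_prE.
Qed.
Lemma sub_gla1 u : sub_endo (gla 1%g) u = u.
Proof. by apply: val_inj; rewrite /= sub_laE // gla1. Qed.
Lemma sub_gra1 u : sub_endo (gra 1%g) u = u.
Proof. by apply: val_inj; rewrite /= sub_raE // gra1. Qed.
Lemma sub_glaM h k u : h \in H -> k \in H ->
  sub_endo (gla (h * k)%g) u = sub_endo (gla h) (sub_endo (gla k) u).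
Proof. by move=> hH kH; apply: val_inj; rewrite /= !sub_laE ?groupM // glaM. Qed.
Lemma sub_graM h k u : h \in H -> k \in H ->
  sub_endo (gra (h * k)%g) u = sub_endo (gra k) (sub_endo (gra h) u).
Proof. by move=> hH kH; apply: val_inj; rewrite /= !sub_raE ?groupM // graM. Qed.
Lemma sub_glra h k u : h \in H -> k \in H ->
  sub_endo (gla h) (sub_endo (gra k) u) = sub_endo (gra k) (sub_endo (gla h) u).
Proof.
move=> hH kH; apply: val_inj; rewrite /= sub_laE // !sub_raE // sub_laE //.
exact: glra.
Qed.
Lemma sub_gla_pr h x u : h \in H ->
  sub_endo (gla h) (sub_endo (gpr x) u) = sub_endo (gpr (h * x)%g) (sub_endo (gla h) u).
Proof.
by move=> hH; apply: val_inj; rewrite /= sub_laE // !sub_prE sub_laE // gla_pr.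
Qed.
Lemma sub_gra_pr k x u : k \in H ->
  sub_endo (gra k) (sub_endo (gpr x) u) = sub_endo (gpr (x * k)%g) (sub_endo (gra k) u).
Proof.
by move=> kH; apply: val_inj; rewrite /= sub_raE // !sub_prE sub_raE // gra_pr.
Qed.

Definition subbimod : gbimod :=
  Gbimod sub_gprM sub_gpr_sum sub_gla1 sub_gra1 sub_glaM sub_graM sub_glra
    sub_gla_pr sub_gra_pr.

Definition subincl : 'Hom(subbimod, V) := linfun (@vsval F V U).

Lemma subinclE u : subincl u = vsval u.
Proof. by rewrite linfunE_lin // => a x y; rewrite linearP. Qed.

Lemma subincl_inj : injective subincl.
Proof. by move=> u v; rewrite !subinclE => /val_inj. Qed.

Lemma homs_subincl : subincl \in homs subbimod V.
Proof.
apply/homsP; split=> [x u | h u hH | h u hH]; rewrite !subinclE.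
- exact: sub_prE.
- exact: sub_laE.
exact: sub_raE.
Qed.

Lemma simple_subbimod : U != 0%VS ->
  (forall U' : {vspace V}, subobject U' -> (U' <= U)%VS -> U' = 0%VS \/ U' = U) ->
  simple subbimod.
Proof.
move=> U0 minU.
have imT : (subincl @: {:subbimod})%VS = U.
  apply/vspaceP => v; apply/memv_imgP/idP => [[u _ ->] | vU].
    by rewrite subinclE subvsP.
  by exists (Subvs vU); rewrite ?memvf // subinclE.
split.
  by move=> T0; case/eqP: U0; rewrite -imT T0 limg0.
move=> U' [Up Ul Ur].
have inj0 (A B : {vspace subbimod}) : (subincl @: A)%VS = (subincl @: B)%VS -> A = B.
  move=> AB; apply/vspaceP => u.
  apply/idP/idP => uA; have := memv_img subincl uA.
    by rewrite AB => /memv_imgP[w wB /subincl_inj ->].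
  by rewrite -AB => /memv_imgP[w wB /subincl_inj ->].
have [sp sl sr] := homsP _ homs_subincl.
have sW : subobject (subincl @: U')%VS.
  split=> [x _ /memv_imgP[u uU ->] | h _ hH /memv_imgP[u uU ->]
          | h _ hH /memv_imgP[u uU ->]].
  - by rewrite -sp memv_img ?Up.
  - by rewrite -sl // memv_img ?Ul.
  by rewrite -sr // memv_img ?Ur.
case: (minU _ sW) => [|E|E].
- by apply/subvP => _ /memv_imgP[u _ ->]; rewrite subinclE subvsP.
- by left; apply: inj0; rewrite E limg0.
by right; apply: inj0; rewrite imT E.
Qed.

End SubObject.

Lemma minimal_subobject (V : gbimod) (K : {vspace V}) : subobject K -> K != 0%VS ->
  exists U : {vspace V}, [/\ subobject U, U != 0%VS, (U <= K)%VS
    & forall U' : {vspace V}, subobject U' -> (U' <= U)%VS -> U' = 0%VS \/ U' = U].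
Proof.
have [n] := ubnP (\dim K); elim: n K => // n IH K; rewrite ltnS => Kn sK K0.
have [[U' [sU' U'0 U'K U'nK]] | noU] := classic (exists U' : {vspace V},
    [/\ subobject U', U' != 0%VS, (U' <= K)%VS & U' <> K]).
  have [|U [sU U0 UU' minU]] := IH U' _ sU' U'0.
    apply: leq_trans Kn; rewrite ltn_neqAle dimvS // andbT.
    by apply: contra_notN U'nK => /eqP E; apply/eqP; rewrite eqEdim U'K E leqnn.
  by exists U; split=> //; apply: subv_trans U'K.
exists K; split=> // U' sU' U'K; have [->|U'0] := eqVneq U' 0%VS; first by left.
by right; apply: NNPP => U'nK; apply: noU; exists U'.
Qed.

Lemma subobjectT (V : gbimod) : subobject ({:V}%VS).
Proof. by split=> *; apply: memvf. Qed.

Lemma subobject_lker (V W : gbimod) (f : 'Hom(V, W)) : f \in homs V W -> subobject (lker f).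
Proof.
move=> /homsP[fp fl fr].
split=> [x v | h v hH | h v hH]; rewrite !memv_ker => /eqP f0.
- by rewrite fp f0 linear0.
- by rewrite fl // f0 linear0.
by rewrite fr // f0 linear0.
Qed.

Lemma subobject_cap (V : gbimod) (U W : {vspace V}) :
  subobject U -> subobject W -> subobject (U :&: W)%VS.
Proof.
move=> [Up Ul Ur] [Wp Wl Wr].
split=> [x v | h v hH | h v hH]; rewrite !memv_cap => /andP[vU vW].
- by rewrite Up ?Wp.
- by rewrite Ul ?Wl.
by rewrite Ur ?Wr.
Qed.

Lemma simple_sub (V : gbimod) : nonzero V ->
  exists (U : gbimod) (f : 'Hom(U, V)), [/\ simple U, f \in homs U V & injective f].
Proof.
move=> [v v0]; have [|U [sU U0 _ minU]] := minimal_subobject (subobjectT V).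
  by apply: contraNneq v0 => V0; rewrite -memv0 -V0 memvf.
exists (subbimod sU), (subincl sU); split; first exact: simple_subbimod.
  exact: homs_subincl.
exact: subincl_inj.
Qed.

Lemma simple_nonzero (U : gbimod) : simple U -> nonzero U.
Proof.
move=> [U0 _]; exists (vpick {:U}%VS); rewrite vpick0.
by apply/eqP.
Qed.

(** Maschke: a linear projection onto U becomes a morphism once it is averaged over
    the degree projections and over the two actions of H. *)
Lemma subobject_proj (V : gbimod) (U : {vspace V}) : subobject U ->
  exists p : 'Hom(V, V), [/\ p \in homs V V, forall v, p v \in U
    & forall u, u \in U -> p u = u].
Proof.
move=> [Up Ul Ur].
pose p0 (v : V) := \sum_x gpr x (projv U (gpr x v)).
have p0l : linear p0.
  move=> a u v; rewrite /p0 scaler_sumr -big_split; apply: eq_bigr => x _.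
  by rewrite !linearP.
have p0U v : p0 v \in U by apply: memv_suml => x _; apply/Up/memv_proj.
have p0id u : u \in U -> p0 u = u.
  move=> uU; rewrite -[RHS]gpr_sum; apply: eq_bigr => x _.
  by rewrite projv_id ?Up // gpr_gpr eqxx.
have p0p y v : p0 (gpr y v) = gpr y (p0 v).
  rewrite /p0 linear_sum; apply: eq_bigr => x _ /=; rewrite !gpr_gpr.
  by have [->|xy] := eqVneq x y; rewrite ?gpr_gpr ?eqxx ?linear0.
pose pf (v : V) := #|H|%:R^-1 *: \sum_(h in H) (#|H|%:R^-1 *: \sum_(k in H)
  gla h (gra k (p0 (gra k^-1%g (gla h^-1%g v))))).
have pl : linear pf.
  move=> a u v; rewrite /pf scalerA mulrC -scalerA -scalerDr; congr (_ *: _).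
  rewrite scaler_sumr -big_split; apply: eq_bigr => h _ /=.
  rewrite scalerA mulrC -scalerA -scalerDr; congr (_ *: _).
  rewrite scaler_sumr -big_split; apply: eq_bigr => k _ /=.
  by rewrite !linearP p0l !linearP.
exists (linfun pf); split.
- apply/homsP; split=> [x v | a v aH | a v aH]; rewrite !(linfunE_lin pl) /pf.
  + rewrite [RHS]linearZ; congr (_ *: _); rewrite linear_sum; apply: eq_bigr => h hH /=.
    rewrite [RHS]linearZ; congr (_ *: _); rewrite linear_sum; apply: eq_bigr => k kH /=.
    rewrite gla_pr ?groupV // gra_pr ?groupV // p0p gra_pr // gla_pr //.
    by rewrite mulgKV mulKVg.
  + rewrite [RHS]linearZ; congr (_ *: _); rewrite linear_sum.
    rewrite (reindex_inj (mulgI a)) /=; apply: eq_big => [h | h ahH].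
      by rewrite groupMl.
    have hH : h \in H by rewrite -(groupMl h aH).
    rewrite [RHS]linearZ; congr (_ *: _); rewrite linear_sum; apply: eq_bigr => k kH /=.
    by rewrite glaM // -[gla (a * h)^-1%g _]glaM ?groupV ?groupM // invMg mulgKV.
  rewrite [RHS]linearZ; congr (_ *: _); rewrite linear_sum; apply: eq_bigr => h hH /=.
  rewrite [RHS]linearZ; congr (_ *: _); rewrite linear_sum.
  rewrite (reindex_inj (mulIg a)) /=; apply: eq_big => [k | k kaH].
    by rewrite groupMr.
  have kH : k \in H by rewrite -(groupMr k aH).
  rewrite [gla h^-1%g (gra a v)]glra ?groupV //.
  rewrite -[gra (k * a)^-1%g _]graM ?groupV ?groupM //.
  by rewrite invMg mulKVg graM // [gla h (gra a _)]glra.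
- move=> v; rewrite (linfunE_lin pl); apply/memvZ/memv_suml => h hH.
  by apply/memvZ/memv_suml => k kH; rewrite Ul ?Ur ?p0U.
move=> u uU; rewrite (linfunE_lin pl) -[RHS](avg_const nzH); congr (_ *: _).
apply: eq_bigr => h hH; rewrite -[RHS](avg_const nzH); congr (_ *: _).
apply: eq_bigr => k kH; rewrite p0id ?Ur ?Ul ?groupV //.
by rewrite -graM ?groupV // mulVg gra1 -glaM ?groupV // mulgV gla1.
Qed.

(** Every object is the sum of its simple subobjects, so naturality for their
    inclusions suffices. *)
Lemma natural_id (t : forall V : gbimod, V -> V) :
  (forall V, linear (t V)) ->
  (forall (V W : gbimod) (f : 'Hom(V, W)) v, f \in homs V W -> t W (f v) = f (t V v)) ->
  (forall U : gbimod, simple U -> forall u, t U u = u) ->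
  forall V v, t V v = v.
Proof.
move=> tl tn ts V.
suff tK (K : {vspace V}) : subobject K -> forall v, v \in K -> t V v = v.
  by move=> v; apply: (tK _ (subobjectT V)); apply: memvf.
have [n] := ubnP (\dim K); elim: n K => // n IH K; rewrite ltnS => Kn sK v vK.
have [K0|K0] := eqVneq K 0%VS.
  move: vK; rewrite K0 memv0 => /eqP ->.
  by rewrite -(linfunE_lin (tl V)) linear0.
have [U [sU U0 UK minU]] := minimal_subobject sK K0.
have [p [pH pU pid]] := subobject_proj sU.
have sK' := subobject_cap sK (subobject_lker pH).
have tU u : u \in U -> t V u = u.
  move=> uU; rewrite -[u]/(vsval (Subvs uU)) -(subinclE (Subvs uU : subbimod sU)).
  rewrite tn ?homs_subincl //.
  by rewrite ts //; apply: simple_subbimod.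
have vE : v = 1 *: p v + (v - p v) by rewrite scale1r addrC subrK.
rewrite [v in LHS]vE tl tU // (IH _ _ sK') -?vE //.
  apply: leq_trans Kn; rewrite ltn_neqAle dimvS ?capvSl // andbT.
  apply/eqP => dimE.
  have /eqP KE : (K :&: lker p)%VS == K by rewrite eqEdim capvSl dimE leqnn.
  case/negP: U0; rewrite -subv0; apply/subvP => u uU.
  have : u \in (K :&: lker p)%VS by rewrite KE (subvP UK).
  by rewrite memv_cap memv_ker pid // memv0 => /andP[].
rewrite memv_cap memv_ker memvB ?(subvP UK _ (pU v)) //=.
by rewrite linearB /= (pid _ (pU v)) subrr.
Qed.

End Subobjects.

Section CanonicalPivot.
Variables (C : numClosedFieldType) (gT : finGroupType) (H : {group gT}).
Local Notation gbimod := (gbimod C H).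

Lemma nz_cardH : #|H|%:R != 0 :> C.
Proof. by rewrite pnatr_eq0 -lt0n cardG_gt0. Qed.

(** Over an algebraically closed field f has an eigenvector, and the eigenspace is a
    subobject. *)
Lemma schur (U : gbimod) (f : 'End(U)) : simple U -> f \in homs U U ->
  exists c : C, forall u, f u = c *: u.
Proof.
move=> sU fH.
pose A : 'M[C]_(\dim {:U}) := \matrix_(i, k) crd k (f (stdb i)).
have [|c /eigenvalueP[v vA v0]] := @eigenvalue_closed C _ A.
  by rewrite lt0n dimv_eq0; apply/eqP; case: sU.
pose g : 'End(U) := (f - c *: \1)%VF.
have gE u : g u = f u - c *: u by rewrite add_lfunE opp_lfunE scale_lfunE id_lfunE.
have gH : g \in homs U U by rewrite memvB // memvZ // homs_id.
exists c => u; apply/eqP; rewrite -subr_eq0 -gE.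
have [_ /(_ _ (subobject_lker gH))[K0|KT]] := sU; last first.
  by rewrite -memv_ker KT memvf.
pose w : U := \sum_i v 0 i *: stdb i.
have crdw i : crd i w = v 0 i.
  rewrite /w crd_sum (bigD1 i) //= crd_stdb eqxx mulr1 big1 ?addr0 // => k /negPf ki.
  by rewrite crd_stdb eq_sym ki mulr0.
have : w \in lker g.
  rewrite memv_ker gE subr_eq0 /w linear_sum scaler_sumr; apply/eqP.
  transitivity (\sum_k (v *m A) 0 k *: stdb k : U).
    under [RHS]eq_bigr do rewrite mxE scaler_suml.
    rewrite exchange_big; apply: eq_bigr => i _ /=.
    rewrite linearZ /= {1}[f (stdb i)]stdb_crd scaler_sumr; apply: eq_bigr => k _.
    by rewrite mxE scalerA.
  by rewrite vA; apply: eq_bigr => k _; rewrite mxE scalerA.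
rewrite K0 memv0 => /eqP w0; case/negP: v0; apply/eqP/rowP => i.
by rewrite -crdw w0 mxE /crd linear0.
Qed.

(** On a simple object U the automorphism [pivdef] is a scalar c, and c is positive
    because the pivotal dimension of U is nonnegative. Naturality and monoidality
    make c^k the scalar of some simple constituent of U^{(x) k}; there are finitely
    many simple objects, so two powers of c coincide and c = 1. *)
Lemma canonical_simple (j : pivotal C H) (U : gbimod) :
  canonical_pivotal j -> simple U -> forall u, pivdef j U u = u.
Proof.
move=> jcan sU; have [c Uc] := schur sU (pivdef_hom j U).
have [l [n [Y [[Ys _ Yall] [l0 _ _]]]] dimU] := jcan U sU.
have jU : piv j U = c *: bidual U.
  by apply/lfunP => u; rewrite scale_lfunE -bidual_pivdef Uc linearZ.
have nU := simple_nonzero sU.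
have lE : l = c * ((\dim {:U})%:R / #|H|%:R).
  have : (ev (dual U) \o tensm (c *: bidual U) \1 \o db U)%VF
       = (c * ((\dim {:U})%:R / #|H|%:R)) *: \1%VF.
    have -> : tensm (c *: bidual U) \1%VF
        = c *: tensm (bidual U) (\1%VF : 'End(dual U)).
      apply: tens_ext => u phi; rewrite scale_lfunE !tensmE ?homs_id ?bidual_hom //.
        by rewrite scale_lfunE tensZl.
      by apply: memvZ; apply: bidual_hom.
    by rewrite -comp_lfunZr -comp_lfunZl bidual_dim scalerA.
  rewrite -jU dimU => /lfunP/(_ (uone C H)); rewrite !scale_lfunE !id_lfunE.
  move/ffunP/(_ 1%g); rewrite !ffunE eqxx /GRing.scale /= !mulr1.
  by [].
have d0 : 0 < (\dim {:U})%:R / #|H|%:R :> C.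
  rewrite divr_gt0 ?ltr0n ?cardG_gt0 // lt0n dimv_eq0.
  by apply/eqP; case: sU.
have c0 : 0 <= c by rewrite -(pmulr_lge0 _ d0) -lE.
suff c1 : c = 1 by move=> u; rewrite Uc c1 scale1r.
have cn0 : c != 0.
  case: nU => u u0; apply: contraNneq u0 => c0'.
  have := bidual_pivdef j u; rewrite Uc c0' scale0r linear0 => j0.
  by apply/eqP/(bij_inj (piv_bij j U)); rewrite linear0.
have constituent k : exists i, forall y, pivdef j (Y i) y = c ^+ k.+1 *: y.
  have [W [f [sW fH fI]]] := simple_sub (nonzero_tensor_power k nU).
  have [i [g [g' [gH g'H gK g'K]]]] := Yall W sW.
  exists i => y; rewrite -[y in LHS]g'K (pivdef_nat j _ gH).
  rewrite -[y in RHS]g'K -linearZ; congr (g _); apply: fI.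
  by rewrite -(pivdef_nat j _ fH) (pivdef_tensor_power nz_cardH Uc) linearZ.
have [i iE] := fin_all_exists (fun k : 'I_n.+1 => constituent k).
have /injectivePn[a [b ab iab]] : ~~ injectiveb i.
  by apply: contraTN isT => /injectiveP/leq_card; rewrite !card_ord ltnn.
have pow_eq : c ^+ a.+1 = c ^+ b.+1.
  have [y y0] := simple_nonzero (Ys (i a)).
  have := iE a y; rewrite iab in y y0 *; rewrite iE => /eqP.
  by rewrite -subr_eq0 -scalerBl scaler_eq0 (negPf y0) orbF subr_eq0 => /eqP.
wlog lt_ab : a b ab iab pow_eq / (a < b)%N.
  move=> W; move: (ab); rewrite -val_eqE neq_ltn => /orP[] lt; first exact: (W a b).
  by apply: (W b a); rewrite 1?eq_sym.
have : c ^+ (b - a) = 1.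
  apply: (mulfI (expf_neq0 a.+1 cn0)).
  by rewrite mulr1 -exprD addSn subnKC ?(ltnW lt_ab).
by move/eqP; rewrite pexpr_eq1 ?subn_gt0 // => /eqP.
Qed.

Lemma canonical_bidual (j : pivotal C H) (V : gbimod) :
  canonical_pivotal j -> piv j V = bidual V.
Proof.
move=> jcan; apply/lfunP => v; rewrite -bidual_pivdef; congr (bidual V _).
apply: (natural_id nz_cardH (t := fun V => pivdef j V)) => [W | W X f w fH | U sU u].
- by move=> a u w; rewrite linearP.
- exact: pivdef_nat.
exact: canonical_simple.
Qed.

End CanonicalPivot.

(** * Traces on the objects F_d(W) *)

Section FibreTrace.
Variables (F : fieldType) (gT : finGroupType) (H : {group gT}).
Local Notation gbimod := (gbimod F H).
Local Notation gpr := (@gpr F gT H _).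
Local Notation gla := (@gla F gT H _).
Local Notation gra := (@gra F gT H _).
Variables (d : gT) (V : gbimod).
Local Notation S := (stab H d).
Local Notation fib := (fibre d V).

Lemma stabP s : reflect (s \in H /\ (s ^ d)%g \in H) (s \in S).
Proof. by rewrite inE mem_conjgV; apply: andP. Qed.

Lemma gpr_fibre x (v : V) : x \in (d *: H)%g -> gpr x v \in fib.
Proof.
move=> xd; rewrite memvE; apply: (sumv_sup x) => //.
by rewrite -memvE memv_img ?memvf.
Qed.

Lemma gpr_fibre0 y (v : V) : v \in fib -> y \notin (d *: H)%g -> gpr y v = 0.
Proof.
move=> vf yd; apply/eqP; rewrite -memv_ker; apply: subvP v vf.
apply/subv_sumP => x xd; apply/subvP => _ /memv_imgP[w _ ->].
rewrite memv_ker gpr_gpr; have [yx|_] := eqVneq y x; last by [].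
by rewrite yx xd in yd.
Qed.

Lemma fibre_sum (v : V) : v \in fib -> v = \sum_(x in (d *: H)%g) gpr x v.
Proof.
move=> vf; rewrite -[LHS]gpr_sum (bigID (fun x => x \in (d *: H)%g)) /=.
by rewrite [X in _ + X]big1 ?addr0 // => x xd; apply: gpr_fibre0.
Qed.

Lemma fibre_gra k v : k \in H -> v \in fib -> gra k v \in fib.
Proof.
move=> kH /fibre_sum ->; rewrite linear_sum; apply: memv_suml => x xd /=.
rewrite gra_pr // gpr_fibre //; move: xd; rewrite !mem_lcoset mulgA.
by rewrite (groupMr _ kH).
Qed.

Lemma fibre_gla s v : s \in S -> v \in fib -> gla s v \in fib.
Proof.
move=> /stabP[sH sdH] /fibre_sum ->; rewrite linear_sum; apply: memv_suml => x xd /=.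
rewrite gla_pr // gpr_fibre //; move: xd; rewrite !mem_lcoset mulgA.
have -> : (d^-1 * s = s ^ d * d^-1)%g by rewrite conjgE !mulgA mulgK.
by rewrite -mulgA (groupMl _ sdH).
Qed.

Definition fclass (v : V) : fibreq d V := qproj (fibre_rel d V) (vsproj fib v).

Lemma fclass_linear : linear fclass.
Proof. by move=> a u v; rewrite /fclass !linearP. Qed.

Lemma fclass_sum I (r : seq I) (P : pred I) (f : I -> V) :
  fclass (\sum_(i <- r | P i) f i) = \sum_(i <- r | P i) fclass (f i).
Proof. by rewrite /fclass !linear_sum. Qed.

Lemma fibre_rel_linear k :
  linear (fun u : subvs_of fib => vsproj fib (gra k (vsval u) - vsval u)).
Proof.
move=> a x y; rewrite -linearP; congr (vsproj _ _).
by rewrite !linearP /= scalerDr addrACA.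
Qed.

(** The chosen representative of the class of v differs from v by a combination of the
    relations m k - m, which g kills. *)
Lemma fibreq_factor (X : vectType F) (g : V -> X) (v : V) : linear g ->
  (forall k u, k \in H -> u \in fib -> g (gra k u) = g u) ->
  v \in fib -> g (vsval (qsec (fibre_rel d V) (fclass v))) = g v.
Proof.
move=> lg gk vf; pose g' := linfun (fun u : subvs_of fib => g (vsval u)).
have lg' : linear (fun u : subvs_of fib => g (vsval u)).
  by move=> a x y; rewrite linearP lg.
have g'0 : (fibre_rel d V <= lker g')%VS.
  apply/subv_sumP => k kH; apply/subvP => _ /memv_imgP[u _ ->].
  have lr := fibre_rel_linear k.
  rewrite memv_ker (linfunE_lin lr) (linfunE_lin lg') vsprojK.
    by rewrite -(linfunE_lin lg) linearB /= !(linfunE_lin lg) gk ?subvsP ?subrr.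
  by rewrite memvB ?fibre_gra ?subvsP.
have := subvP g'0 _ (qproj_sec (fibre_rel d V) (vsproj fib v)).
rewrite memv_ker linearB /= !(linfunE_lin lg') vsprojK // subr_eq0 => /eqP <-.
by [].
Qed.

Lemma fclass_gra k v : k \in H -> v \in fib -> fclass (gra k v) = fclass v.
Proof.
move=> kH vf; apply/eqP; rewrite -subr_eq0 /fclass -!linearB /= qproj_ker.
rewrite memvE; apply: (sumv_sup k) => //; rewrite -memvE.
apply/memv_imgP; exists (vsproj fib v); rewrite ?memvf //.
by rewrite (linfunE_lin (fibre_rel_linear k)) vsprojK.
Qed.

Lemma fibreq_actE s v : s \in S -> v \in fib ->
  fibreq_act d V s (fclass v) = fclass (gla s v).
Proof.
move=> sS vf; have [sH _] := stabP _ sS.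
rewrite linfunE_lin => [|a x y]; last by rewrite !linearP.
have E := @fibreq_factor _ (fun u => fclass (gla s u)) v.
apply: E => //; first by move=> a x y; rewrite linearP fclass_linear.
move=> k u kH uf; rewrite glra // fclass_gra // fibre_gla //.
Qed.

Section Degree.
Variable r : gT.
Hypothesis rd : r \in (d *: H)%g.

(** Every class in (M_{dH})/H has a unique representative of degree r: translate the
    homogeneous components of any representative to degree r by the right action. *)
Definition frep (q : fibreq d V) : V :=
  gpr r (\sum_(k in H) gra k (vsval (qsec (fibre_rel d V) q))).

Lemma frep_linear : linear frep.
Proof.
move=> a p q; rewrite /frep -linearP; congr (gpr r _).
rewrite scaler_sumr -big_split; apply: eq_bigr => k _ /=.
by rewrite !linearP.
Qed.

Lemma frep_class v : frep (fclass (gpr r v)) = gpr r v.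
Proof.
rewrite /frep (@fibreq_factor _ (fun u => gpr r (\sum_(k in H) gra k u))) ?gpr_fibre //.
- rewrite (bigD1 1%g) //= gra1 linearD /= gpr_gpr eqxx linear_sum big1 ?addr0 //.
  move=> k /andP[kH /negPf k1]; rewrite /= gra_pr // gpr_gpr.
  by rewrite -[X in X == _]mulg1 (inj_eq (mulgI r)) eq_sym k1.
- move=> a x y; rewrite -linearP; congr (gpr r _).
  by rewrite scaler_sumr -big_split; apply: eq_bigr => k _; rewrite /= linearP.
move=> k u kH uf; congr (gpr r _); rewrite [RHS](reindex_inj (mulgI k)) /=.
by apply: eq_big => [h | h hH]; rewrite ?groupMl // graM.
Qed.

Lemma class_frep q : fclass (frep q) = q.
Proof.
rewrite /frep linear_sum; set u := vsval _.
have uf : u \in fib by apply: subvsP.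
transitivity (\sum_(k in H) fclass (gpr (r * k^-1)%g u)).
  rewrite fclass_sum; apply: eq_bigr => k kH /=.
  rewrite -[in LHS](mulgKV k r) -gra_pr // fclass_gra // gpr_fibre //.
  by move: rd; rewrite !mem_lcoset mulgA (groupMr _ (groupVr kH)).
rewrite -fclass_sum.
transitivity (fclass u); last by rewrite /fclass /u vsvalK qsecK.
congr fclass; rewrite [RHS]fibre_sum // -(lcoset_eqP rd).
rewrite [RHS](reindex (fun k => (r * k^-1)%g)) /=.
  by apply: eq_bigl => k; rewrite mem_lcoset mulKg groupV.
by exists (fun x => (x^-1 * r)%g) => x _; rewrite ?invMg ?invgK ?mulgKV ?mulKVg.
Qed.

(** The bijection between V_r and (M_{dH})/H carries v |-> s v s^-1 to the action of s,
    since s v s^-1 and s v have the same class. *)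
Lemma deg_trace_act s : s \in S -> (s * r * s^-1)%g = r ->
  deg_trace V r s = ltr (fibreq_act d V s).
Proof.
move=> sS sr; have [sH _] := stabP _ sS.
transitivity (ltr (fun v : V => gla s (gra s^-1%g (frep (fclass (gpr r v)))))).
  by apply: eq_ltr => v; rewrite frep_class.
rewrite (@ltr_comm _ V (fibreq d V) (fun v => fclass (gpr r v))
  (fun q => gla s (gra s^-1%g (frep q)))); first last.
- by move=> a p q; rewrite frep_linear !linearP.
- by move=> a u v; rewrite linearP fclass_linear.
apply: eq_ltr => q; rewrite -[q in RHS]class_frep.
have repr_r : frep q = gpr r (frep q) by rewrite /frep gpr_gpr eqxx.
have rep_fib : frep q \in fib by rewrite /frep gpr_fibre.
rewrite repr_r gpr_bimul ?groupV // sr eqxx -repr_r.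
by rewrite glra ?groupV // fclass_gra ?groupV ?fibre_gla // fibreq_actE.
Qed.

Lemma deg_trace_repr n (rW : mx_representation F S n) s :
  is_Fd V rW -> s \in S -> (s * r * s^-1)%g = r -> deg_trace V r s = \tr (rW s).
Proof.
move=> [_ [phi [[psi phiK psiK] phis]]] sS sr; rewrite deg_trace_act //.
have lpsi : linear psi.
  by move=> a u v; apply: (can_inj phiK); rewrite linearD linearZ /= !psiK.
transitivity (ltr (fun q => psi (rW s *m phi q))).
  by apply: eq_ltr => q; rewrite -phis // phiK.
rewrite ltr_comm //; last by move=> a u v; rewrite !linearP.
by rewrite -ltr_mx; apply: eq_ltr => w; rewrite psiK.
Qed.

End Degree.

Lemma deg_trace0 n (rW : mx_representation F S n) r a :
  is_Fd V rW -> r \notin ((H :* d) * H)%g -> deg_trace V r a = 0.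
Proof.
move=> [V0 _] rn; rewrite -[RHS](ltr0 V); apply: eq_ltr => v.
by rewrite V0 // !linear0.
Qed.

Lemma deg_trace_conj r a h : h \in H -> a \in H ->
  deg_trace V (h * r * h^-1)%g (h * a * h^-1)%g = deg_trace V r a.
Proof.
move=> hH aH.
have hahH : (h * a * h^-1)%g \in H by rewrite !groupM ?groupV.
pose B (v : V) := gla a (gra a^-1%g (gpr r (gra h (gla h^-1%g v)))).
transitivity (ltr (fun v : V => gla h (gra h^-1%g (B v)))).
  apply: eq_ltr => v; rewrite /B; set w := gpr r _.
  have -> : gpr (h * r * h^-1)%g v = gla h (gra h^-1%g w).
    rewrite /w gra_pr ?groupV // gla_pr // mulgA.
    by rewrite -graM ?groupV // mulgV gra1 -glaM ?groupV // mulgV gla1.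
  rewrite -[gra _ (gla h (gra h^-1%g w))]glra ?groupV //.
  rewrite -[gra _ (gra h^-1%g w)]graM ?groupV //.
  rewrite !invMg invgK !mulgA mulVg mul1g -glaM // mulgKV.
  by rewrite graM ?groupV // glaM // [gla a (gra h^-1%g _)]glra ?groupV.
have lB : linear B by move=> c u v; rewrite /B !linearP.
have lC : linear (fun v : V => gla h (gra h^-1%g v)) by move=> c u v; rewrite !linearP.
rewrite (ltr_comm lB lC).
apply: eq_ltr => v; rewrite /B -glaM ?groupV // mulVg gla1.
by rewrite -graM ?groupV // mulVg gra1.
Qed.

End FibreTrace.

(** * Orbit sums *)

Section OrbitSums.
Variables (C : numClosedFieldType) (gT : finGroupType).

Lemma conj_orbitE (K : {group gT}) r : conj_orbit K r = (r ^: K)%g.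
Proof.
apply/setP => x; apply/imsetP/imsetP => [[s sK ->] | [s sK ->]].
  by exists (s^-1)%g; rewrite ?groupV // conjgE invgK mulgA.
by exists (s^-1)%g; rewrite ?groupV // conjgE invgK mulgA.
Qed.

(** Each r in X has the same value as the unique t of T in its orbit; count the pairs
    (r, t). *)
Lemma orbit_reps_sum (K : {group gT}) (X T : {set gT}) (f : gT -> C) :
  orbit_reps (conj_orbit K) X T ->
  (forall x r, x \in K -> r \in X -> (x * r * x^-1)%g \in X) ->
  (forall x r, x \in K -> r \in X -> f (x * r * x^-1)%g = f r) ->
  \sum_(r in T) #|K|%:R / #|K :&: 'C[r]%g|%:R * f r = \sum_(r in X) f r.
Proof.
move=> [/subsetP TX T1] KX fK.
have orbX t r : t \in X -> r \in conj_orbit K t -> r \in X.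
  by move=> tX /imsetP[x xK ->]; apply: KX.
transitivity (\sum_(r in X) \sum_(t in T | t \in conj_orbit K r) f t); last first.
  apply: eq_bigr => r rX; rewrite (eq_bigr (fun=> f r)); last first.
    by move=> t /andP[_ /imsetP[x xK ->]]; apply: fK.
  rewrite sumr_const -[X in _ *+ X = _](_ : 1%N = _) ?mulr1n // -(T1 r rX).
  by apply: eq_card => t; rewrite !inE.
rewrite (exchange_big_dep (fun t => t \in T)) /=; last by move=> r t _ /andP[].
apply: eq_bigr => t tT; rewrite sumr_const -[RHS]mulr_natl; congr (_ * _).
have -> : #|[pred r in X | (t \in T) && (t \in conj_orbit K r)]| = #|(t ^: K)%g|.
  apply: eq_card => r; rewrite !inE tT /= conj_orbitE class_sym -conj_orbitE.
  by case: (boolP (r \in conj_orbit K t)) => [/(orbX t r (TX t tT)) -> | _]; rewrite ?andbF.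
rewrite -index_cent1 -(LagrangeI K 'C[t]) indexgI natrM mulrAC mulfV ?mul1r //.
by rewrite pnatr_eq0 -lt0n cardG_gt0.
Qed.

End OrbitSums.

Section Characters.
Variables (C : numClosedFieldType) (gT : finGroupType) (G : {group gT}).

(** Every representation preserves a positive definite Hermitian form P, the average of
    the standard one; so rG x^-1 is conjugate by P to the adjoint of rG x. *)
Lemma trace_reprV n (rG : mx_representation C G n) x :
  x \in G -> \tr (rG x^-1%g) = (\tr (rG x))^*.
Proof.
move=> xG; pose adj m p (A : 'M[C]_(m, p)) : 'M[C]_(p, m) := map_mx Num.conj (A^T).
have adjM m p q (A : 'M_(m, p)) (B : 'M_(p, q)) : adj _ _ (A *m B) = adj _ _ B *m adj _ _ A.
  by rewrite /adj trmx_mul map_mxM.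
pose P := \sum_(y in G) adj n n (rG y) *m rG y.
have Px : adj n n (rG x) *m P *m rG x = P.
  rewrite /P mulmx_sumr mulmx_suml [RHS](reindex_inj (mulIg x)) /=.
  apply: eq_big => [y | y yG]; first by rewrite groupMr.
  by rewrite repr_mxM // adjM !mulmxA.
have PU : P \in unitmx.
  rewrite -row_free_unit -kermx_eq0; apply/rowV0P => v /sub_kermxP vP.
  have pos p (w : 'rV[C]_p) : 0 <= (w *m adj _ _ w) 0 0.
    by rewrite mxE sumr_ge0 // => i _; rewrite !mxE mul_conjC_ge0.
  have : \sum_(y in G) ((v *m adj n n (rG y)) *m adj _ _ (v *m adj n n (rG y))) 0 0 = 0.
    transitivity ((v *m P *m adj _ _ v) 0 0); last by rewrite vP mul0mx mxE.
    rewrite /P mulmx_sumr mulmx_suml summxE; apply: eq_bigr => y yG.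
    rewrite adjM !mulmxA; congr ((_ *m _ *m _) 0 0).
    by apply/matrixP => a b; rewrite !mxE conjCK.
  move/eqP; rewrite psumr_eq0 => [|y _]; last exact: pos.
  move/allP/(_ 1%g (mem_index_enum _)); rewrite group1 repr_mx1 /=.
  have -> : adj n n 1%:M = 1%:M by rewrite /adj trmx1 map_mx1.
  rewrite mulmx1 mxE psumr_eq0 => [/allP v0 | i _]; last by rewrite !mxE mul_conjC_ge0.
  apply/rowP => i; have := v0 i (mem_index_enum _).
  by rewrite !mxE mul_conjC_eq0 => /eqP.
have E : adj n n (rG x) *m P = P *m rG x^-1%g.
  rewrite -[in RHS]Px -mulmxA -repr_mxM ?groupV // mulgV repr_mx1 mulmx1.
  by [].
have -> : rG x^-1%g = invmx P *m (adj n n (rG x) *m P) by rewrite E mulKmx.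
by rewrite mxtrace_mulC -mulmxA mulmxV // mulmx1 trace_map_mx mxtrace_tr.
Qed.

Lemma trace_reprJ n (rG : mx_representation C G n) x y :
  x \in G -> y \in G -> \tr (rG (x * y * x^-1)%g) = \tr (rG y).
Proof.
move=> xG yG; rewrite !repr_mxM ?groupM ?groupV // mxtrace_mulC mulmxA.
by rewrite -repr_mxM ?groupV // mulVg repr_mx1 mul1mx.
Qed.

End Characters.

(** * The stabilizer and its normalizing set *)

Section StabilizerGroup.
Variables (gT : finGroupType) (H : {group gT}) (d : gT).
Local Notation S := (stab H d).
Local Notation E := (Eset H d).

Lemma Eset_normS : E \subset ('N(S))%g.
Proof.
apply/subsetP => e /setIP[/setIP[/cent1P ed _] /normP eH]; apply/normP.
rewrite conjIg eH; congr (_ :&: _).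
have ed' : (d^-1 * e = e * d^-1)%g by apply: (mulgI d); rewrite mulKVg mulgA -ed mulgK.
by rewrite -conjsgM ed' conjsgM eH.
Qed.

Lemma stab_Eset_comm : (S * E)%g = (E * S)%g.
Proof. exact/esym/normC/Eset_normS. Qed.

Lemma stab_Eset_group : group_set (S * E)%g.
Proof.
have EE : E = ('C[d] :&: (S <*> 'C(S)) :&: 'N(H))%G :> {set gT}.
  by rewrite /Eset /= norm_joinEr // cent_sub.
rewrite EE; apply/comm_group_setP; rewrite /commute -EE.
exact: stab_Eset_comm.
Qed.

(** As C_G(S) acts trivially on S, all of SE thus acts on S by inner automorphisms. *)
Lemma stab_Eset_sub : (S * E)%g \subset (S * 'C(S))%g.
Proof.
have sS : (S * (S * 'C(S)))%g = (S * 'C(S))%g by rewrite mulgA mulGid.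
rewrite -sS mulgS //.
by apply/subsetP => e /setIP[/setIP[]].
Qed.

Lemma stab_Eset_norm x y : x \in (S * E)%g -> ((x * y * x^-1)%g \in S) = (y \in S).
Proof.
move=> xSE; have xN : (x^-1)%g \in ('N(S))%g.
  rewrite groupV; apply: subsetP x xSE.
  by rewrite mul_subG ?normG ?Eset_normS.
have -> : (x * y * x^-1 = y ^ x^-1)%g by rewrite conjgE invgK mulgA.
by rewrite memJ_norm.
Qed.

Lemma stab_Eset_coset x r : x \in (S * E)%g -> r \in (d *: H)%g ->
  (x * r * x^-1)%g \in (d *: H)%g.
Proof.
move=> /mulsgP[s e sS eE ->]; rewrite !mem_lcoset => rH.
have [sH sdH] := stabP _ _ _ sS.
have /setIP[/setIP[/cent1P ed _] eN] := eE.
have -> : (d^-1 * (s * e * r * (s * e)^-1) =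
  s ^ d * ((d^-1 * r) ^ e^-1 * s^-1))%g.
  by rewrite invMg !conjgE invgK !mulgA -(mulgA _ d e) -ed mulgA mulgK.
by rewrite groupM // groupM ?groupV // memJ_norm ?groupV.
Qed.

End StabilizerGroup.

Section CosetSum.
Variables (C : numClosedFieldType) (gT : finGroupType) (H : {group gT}) (d : gT).
Local Notation S := (stab H d).

(** Count the pairs (h, x) with x in h (dH) h^-1 = h dH: an x in HdH occurs for the h
    of a single coset of S in H. *)
Lemma double_coset_sum (f : gT -> C) :
  (forall h r, h \in H -> f (h * r * h^-1)%g = f r) ->
  (forall r, r \notin ((H :* d) * H)%g -> f r = 0) ->
  #|H|%:R^-1 * \sum_r f r = #|S|%:R^-1 * \sum_(r in (d *: H)%g) f r.
Proof.
move=> fJ f0.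
have nzH : #|H|%:R != 0 :> C by rewrite pnatr_eq0 -lt0n cardG_gt0.
have nzS : #|S|%:R != 0 :> C by rewrite pnatr_eq0 -lt0n cardG_gt0.
suff E : #|S|%:R * \sum_r f r = #|H|%:R * \sum_(r in (d *: H)%g) f r.
  by apply: (mulfI nzS); rewrite mulVKf // mulrCA E mulKf.
transitivity (\sum_(h in H) \sum_(x | (h^-1 * x * h)%g \in (d *: H)%g) f x); last first.
  rewrite mulr_natl -sumr_const; apply: eq_bigr => h hH.
  rewrite (reindex_inj (conjg_inj h^-1%g)) /=.
  have cE r : (r ^ h^-1 = h * r * h^-1)%g by rewrite conjgE invgK mulgA.
  apply: eq_big => [r | r _]; last by rewrite cE fJ.
  by rewrite cE !mulgA mulVg mul1g mulgKV.
rewrite (exchange_big_dep predT) //= mulr_sumr; apply: eq_bigr => x _.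
rewrite sumr_const -[RHS]mulr_natl.
have [xHdH|/f0 ->] := boolP (x \in ((H :* d) * H)%g); last by rewrite !mulr0.
congr (_%:R * _).
have /mulsgP[_ k /rcosetP[h0 h0H ->] kH xE] := xHdH.
rewrite -(card_lcoset S h0); apply: eq_card => h.
rewrite mem_lcoset [RHS]unfold_in; apply/esym.
have [hH|hH] := boolP (h \in H); last first.
  by apply/esym/negbTE; apply: contra hH => /stabP[]; rewrite groupMl ?groupV.
apply/idP/stabP => [| [_ uH]].
  rewrite mem_lcoset xE => uH; split; first by rewrite groupM ?groupV.
  move: uH; rewrite (_ : _ * _ = ((h0^-1 * h) ^ d)^-1 * (k * h))%g.
    by rewrite groupMr ?groupV // groupM.
  by rewrite conjgE !invMg !invgK !mulgA.
rewrite mem_lcoset xE (_ : _ * _ = ((h0^-1 * h) ^ d)^-1 * (k * h))%g.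
  by rewrite !groupM ?groupV.
by rewrite conjgE !invMg !invgK !mulgA.
Qed.

End CosetSum.

(** * The orbit formulas *)

Section Formula.
Variables (C : numClosedFieldType) (gT : finGroupType) (H : {group gT}) (d : gT).
Local Notation S := (stab H d).
Variables (n : nat) (rW : mx_representation C S n).

(** Since r commutes with r^m, the latter lies in H if and only if it lies in
    r H r^-1 = d H d^-1. *)
Lemma lcoset_stab_pow m r : r \in (d *: H)%g -> ((r ^+ m)%g \in H) = ((r ^+ m)%g \in S).
Proof.
rewrite mem_lcoset => rH; apply/idP/stabP => [rmH | []] //; split=> //.
have rE : r = (d * (d^-1 * r))%g by rewrite mulKVg.
have rr : ((r ^+ m) ^ r = r ^+ m)%g by rewrite conjXg conjgE mulKg.
rewrite -(mulgK (d^-1 * r)%g d) -rE conjgM rr.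
by rewrite groupJ ?groupV.
Qed.

Lemma nu_lcoset_sum (V : gbimod C H) (j : pivotal C H) m :
  is_Fd V rW -> canonical_pivotal j -> (0 < m)%N ->
  nu j m V = #|S|%:R^-1 *
    \sum_(r in (d *: H)%g) if (r ^+ m)%g \in S then (\tr (rW (r ^+ m)%g))^* else 0.
Proof.
move=> VW jcan m0.
rewrite (nu_deg_trace (nz_cardH C H) (canonical_bidual V jcan) m0) big_mkcond.
rewrite (double_coset_sum (d := d)).
- congr (_ * _); apply: eq_bigr => r rd; rewrite (lcoset_stab_pow m rd).
  case: ifP => // rmS; rewrite (deg_trace_repr rd VW) ?groupV ?trace_reprV //.
  by rewrite invgK -mulgA -expgS expgSr mulKg.
- move=> h r hH.
  have cE x : (h * x * h^-1 = x ^ h^-1)%g by rewrite conjgE invgK mulgA.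
  rewrite cE -conjXg memJ_norm ?groupV ?(subsetP (normG H)) //.
  case: ifP => // rmH; rewrite -conjVg -!cE deg_trace_conj ?groupV //.
by move=> r rn; case: ifP => // _; apply: deg_trace0 VW rn.
Qed.

Lemma trace_stab_Eset x y : x \in (S * Eset H d)%g -> y \in S ->
  \tr (rW (x * y * x^-1)%g) = \tr (rW y).
Proof.
move=> /(subsetP (stab_Eset_sub H d)) /mulsgP[s c sS /centP cS ->] yS.
rewrite invMg !mulgA -[(s * c * y)%g]mulgA (cS y yS) !mulgA mulgK.
exact: trace_reprJ.
Qed.

Lemma nu_orbit_sum (V : gbimod C H) (j : pivotal C H) m (K : {group gT}) (T : {set gT}) :
  is_Fd V rW -> canonical_pivotal j -> (0 < m)%N -> K \subset (S * Eset H d)%g ->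
  orbit_reps (conj_orbit K) (d *: H)%g T ->
  nu j m V = #|S|%:R^-1 *
    \sum_(r in T | (r ^+ m)%g \in S)
      #|K|%:R / #|K :&: 'C[r]%g|%:R * (\tr (rW (r ^+ m)%g))^*.
Proof.
move=> VW jcan m0 /subsetP KSE Trep; rewrite (nu_lcoset_sum VW jcan m0); congr (_ * _).
rewrite -(orbit_reps_sum Trep) => [|x r /KSE xK|x r /KSE xK rd].
- rewrite [RHS]big_mkcondr; apply: eq_bigr => r _.
  by case: ifP => // _; rewrite mulr0.
- exact: stab_Eset_coset.
have -> : ((x * r * x^-1) ^+ m = x * r ^+ m * x^-1)%g.
  have cE y : (x * y * x^-1 = y ^ x^-1)%g by rewrite conjgE invgK mulgA.
  by rewrite !cE conjXg.
rewrite stab_Eset_norm //; case: ifP => // rmS.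
by rewrite trace_stab_Eset.
Qed.

Lemma orbit_reps_lcoset (K : {group gT}) (T : {set gT}) :
  orbit_reps (tconj_orbit d K) H T -> orbit_reps (conj_orbit K) (d *: H)%g (d *: T)%g.
Proof.
move=> [TH T1]; split; first by rewrite mulgS.
move=> x /lcosetP[h hH ->]; rewrite -(T1 h hH) -(card_lcoset (T :&: _) d).
apply: eq_card => y; rewrite inE !mem_lcoset inE; congr (_ && _).
apply/imsetP/imsetP => [[s sK yE] | [s sK yE]]; exists s => //.
  by rewrite yE !mulgA.
by rewrite -[y](mulKVg d) yE !mulgA mulgV mul1g.
Qed.

End Formula.

Theorem proposition4p8 (R : realType) (gT : finGroupType) (H : {group gT}) (d : gT) :
  ((stab H d * Eset H d)%g = (Eset H d * stab H d)%g /\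
   group_set (stab H d * Eset H d)%g) /\
  forall (n : nat) (rW : mx_representation R[i] (stab H d) n)
    (V : gbimod R[i] H) (j : pivotal R[i] H) (m : nat) (S' : {group gT}),
    is_Fd V rW -> canonical_pivotal j -> (0 < m)%N ->
    S' \subset (stab H d * Eset H d)%g ->
    (forall T : {set gT}, orbit_reps (conj_orbit S') (d *: H)%g T ->
      nu j m V = #|stab H d|%:R^-1 *
        \sum_(r in T | (r ^+ m)%g \in stab H d)
          #|S'|%:R / #|S' :&: 'C[r]%g|%:R * (\tr (rW (r ^+ m)%g))^*) /\
    (forall T : {set gT}, orbit_reps (tconj_orbit d S') H T ->
      nu j m V = #|stab H d|%:R^-1 *
        \sum_(h in T | ((d * h) ^+ m)%g \in stab H d)
          #|S'|%:R / #|S' :&: 'C[(d * h)%g]%g|%:R * (\tr (rW ((d * h) ^+ m)%g))^*).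
Proof.
split; first by split; [exact: stab_Eset_comm | exact: stab_Eset_group].
move=> n rW V j m S' VW jcan m0 S'SE; split=> T Trep.
  exact: nu_orbit_sum.
rewrite (nu_orbit_sum VW jcan m0 S'SE (orbit_reps_lcoset Trep)); congr (_ * _).
rewrite (reindex_inj (mulgI d)) /=; apply: eq_bigl => h.
by rewrite mem_lcoset mulKg.
Qed.
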